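(* There exists a (finite) access structure $\mathcal{A}$ which is almost ideal but whose dual access structure $\mathcal{A}^\perp$ is not almost ideal.
   Context: A polymatroid $(f,M)$ consists of a finite set $M$ and a function $f$ on subsets of $M$ with $f(\emptyset)=0$ that is non-negative, monotone and submodular. It is entropic if there are jointly distributed discrete random variables $\langle\xi_i:i\in M\rangle$ with $f(A)=\mathbf H(\xi_A)$ (Shannon entropy) for all $A\subseteq M$; it is almost entropic if, viewed as a vector in $\mathbb R^{2^{|M|}-1}$, it lies in the closure of the set of entropic polymatroids on $M$. An access structure on a finite participant set $P$ is a non-empty upward-closed family $\mathcal{A}\subseteq 2^P$ with $\emptyset\notin\mathcal{A}$; its members are called qualified. Its dual is $\mathcal{A}^\perp=\{A\subseteq P: P\setminus A\notin\mathcal{A}\}$. Let $s\notin P$ (the secret); juxtaposition denotes union, e.g. $sA=\{s\}\cup A$. A polymatroid $(f,sP)$ realizes $\mathcal{A}$ if for every $A\subseteq P$: $A\in\mathcal{A}$ iff $f(sA)=f(A)$, and $A\notin\mathcal{A}$ iff $f(sA)=f(A)+f(s)$. The complexity of such a polymatroid is $\sigma(\mathcal M)=\max_{i\in P} f(i)/f(s)$. $\mathcal{A}$ is almost ideal if it is realized by some almost entropic polymatroid of complexity $1$. *)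

(* Defs.v *)
From mathcomp Require Import all_boot.
From Stdlib Require Import Reals.
Set Implicit Arguments. Unset Strict Implicit. Unset Printing Implicit Defensive.

Local Open Scope R_scope.

(* Shannon entropy of the subfamily xi_A of random variables xi : M -> Omega -> nat,
   defined on a finite probability space (Omega, p):
     H(xi_A) = - E[ ln Pr(xi_A = xi_A(w)) ] = - sum_w p(w) ln q_A(w),
   where q_A(w) is the probability of the atom {w' | xi_A(w') = xi_A(w)}. *)
Definition atom_prob (Omega M : finType) (p : Omega -> R) (xi : M -> Omega -> nat)
  (A : {set M}) (w : Omega) : R :=
  \big[Rplus/0]_(w' : Omega | [forall i in A, xi i w' == xi i w]) p w'.

Definition entropy (Omega M : finType) (p : Omega -> R) (xi : M -> Omega -> nat)
  (A : {set M}) : R :=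
  - \big[Rplus/0]_(w : Omega) (p w * ln (atom_prob p xi A w)).

Definition polymatroid (M : finType) (f : {set M} -> R) : Prop :=
  f set0 = 0 /\
  (forall A, 0 <= f A) /\
  (forall A B : {set M}, A \subset B -> f A <= f B) /\
  (forall A B : {set M}, f (A :|: B) + f (A :&: B) <= f A + f B).

Definition entropic (M : finType) (f : {set M} -> R) : Prop :=
  exists (Omega : finType) (p : Omega -> R) (xi : M -> Omega -> nat),
    (forall w, 0 <= p w) /\ \big[Rplus/0]_(w : Omega) p w = 1 /\
    (forall A : {set M}, f A = entropy p xi A).

(* closure of the entropic vectors in R^(2^|M|-1) (sup-norm = Euclidean topology) *)
Definition almost_entropic (M : finType) (f : {set M} -> R) : Prop :=
  forall eps : R, 0 < eps ->
    exists g : {set M} -> R, entropic g /\ forall A : {set M}, Rabs (f A - g A) < eps.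

Definition access_structure (P : finType) (Acc : {set {set P}}) : Prop :=
  Acc != set0 /\ set0 \notin Acc /\
  (forall A B : {set P}, A \in Acc -> A \subset B -> B \in Acc).

Definition dual (P : finType) (Acc : {set {set P}}) : {set {set P}} :=
  [set A : {set P} | ~: A \notin Acc].

(* ground set sP = option P, the secret s is None, participant i is Some i *)
Definition lift_set (P : finType) (A : {set P}) : {set option P} := Some @: A.
Definition with_secret (P : finType) (A : {set P}) : {set option P} :=
  None |: lift_set A.

Definition realizes (P : finType) (f : {set option P} -> R) (Acc : {set {set P}}) : Prop :=
  forall A : {set P},
    (A \in Acc <-> f (with_secret A) = f (lift_set A)) /\
    (A \notin Acc <-> f (with_secret A) = f (lift_set A) + f [set None]).

Definition complexity (P : finType) (f : {set option P} -> R) : R :=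
  \big[Rmax/0]_(i : P) (f [set Some i] / f [set None]).

Definition almost_ideal (P : finType) (Acc : {set {set P}}) : Prop :=
  exists f : {set option P} -> R,
    polymatroid f /\ almost_entropic f /\ realizes f Acc /\ complexity f = 1.

(* Main.v *)
Require Import Defs.
From HB Require Import structures.
From mathcomp Require Import all_boot.
From Stdlib Require Import Reals Lra ZArith.

(** Random hashing shows that the free expansion of an integer almost entropic
    polymatroid is an almost entropic matroid: hash [N] i.i.d. copies of the
    variables to blocks of [N] bits. By Jensen's inequality the average joint
    entropy of the hashes is at least the expectation of the minimum, over the
    sets [K] of original variables, of the information content of [xi_K] plus the
    number of bits hashed from outside [K]; information contents concentrate, so
    asymptotically this is the rank of the expansion.

    The integer polymatroid is a rounding of the entropy vector of an explicit
    distribution on [{0,1}^3] violating the dual of the five-variable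
    Makarychev-Makarychev-Romashchenko-Vereshchagin inequality. Its expansion is
    enlarged by generic elements, one of which is the secret, so the port of the
    secret is almost ideal. Conversely, in a complexity 1 realization of the dual
    access structure, conditioning on the secret leaves exactly the dual rank:
    circuits of the dual matroid bound it from above, and one spanning circuit
    (the complement of the generic participants) bounds it from below. Conditioned
    also on the generic participants, the blocks of the expansion then carry the
    dual of the integer polymatroid, which violates the inequality. *)

Set Implicit Arguments. Unset Strict Implicit. Unset Printing Implicit Defensive.
Local Open Scope R_scope.

(** * Real sums and atoms *)

HB.instance Definition _ := Monoid.isComLaw.Build R 0 Rplus
  (fun x y z => esym (Rplus_assoc x y z)) Rplus_comm Rplus_0_l.
HB.instance Definition _ := Monoid.isComLaw.Build R 1 Rmult
  (fun x y z => esym (Rmult_assoc x y z)) Rmult_comm Rmult_1_l.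
HB.instance Definition _ := Monoid.isMulLaw.Build R 0 Rmult Rmult_0_l Rmult_0_r.
HB.instance Definition _ := Monoid.isAddLaw.Build R Rmult Rplus
  Rmult_plus_distr_r Rmult_plus_distr_l.

Lemma rsum_le (I : finType) (P : pred I) (F G : I -> R) :
  (forall i, P i -> F i <= G i) ->
  \big[Rplus/0]_(i | P i) F i <= \big[Rplus/0]_(i | P i) G i.
Proof. by move=> h; elim/big_ind2: _ => // *; lra. Qed.

Lemma rsum_ge0 (I : finType) (P : pred I) (F : I -> R) :
  (forall i, P i -> 0 <= F i) -> 0 <= \big[Rplus/0]_(i | P i) F i.
Proof. by move=> h; elim/big_ind: _ => // *; lra. Qed.

Lemma rsum_le_subset (I : finType) (P Q : pred I) (F : I -> R) :
  (forall i, 0 <= F i) -> (forall i, P i -> Q i) ->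
  \big[Rplus/0]_(i | P i) F i <= \big[Rplus/0]_(i | Q i) F i.
Proof.
move=> h pq; rewrite big_mkcond [X in _ <= X]big_mkcond.
apply: rsum_le => i _; have := h i; case: (boolP (P i)) => [/pq ->|_]; first by lra.
by case: ifP => _; lra.
Qed.

Lemma rsum_ge_term (I : finType) (P : pred I) (F : I -> R) i :
  (forall i, 0 <= F i) -> P i -> F i <= \big[Rplus/0]_(i | P i) F i.
Proof.
move=> h pi; rewrite (bigD1 i) //=.
suff : 0 <= \big[Rplus/0]_(j | P j && (j != i)) F j by lra.
exact: rsum_ge0.
Qed.

Lemma rsum_mull (I : finType) (P : pred I) (a : R) (F : I -> R) :
  \big[Rplus/0]_(i | P i) (a * F i) = a * \big[Rplus/0]_(i | P i) F i.
Proof. by rewrite big_distrr. Qed.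

Lemma rsum_mulr (I : finType) (P : pred I) (a : R) (F : I -> R) :
  \big[Rplus/0]_(i | P i) (F i * a) = \big[Rplus/0]_(i | P i) F i * a.
Proof. by rewrite big_distrl. Qed.

Lemma rsumN (I : finType) (P : pred I) (F : I -> R) :
  \big[Rplus/0]_(i | P i) (- F i) = - \big[Rplus/0]_(i | P i) F i.
Proof.
rewrite -(Rmult_1_l (\big[_/_]_(i | P i) F i)) Ropp_mult_distr_l -rsum_mull.
by apply: eq_bigr => i _; lra.
Qed.

Lemma rsum_const (I : finType) (P : pred I) (a : R) :
  \big[Rplus/0]_(i | P i) a = INR #|P| * a.
Proof.
rewrite big_const; elim: #|P| => [|n ih]; first by rewrite /=; lra.
by rewrite iterS ih S_INR; lra.
Qed.

Lemma ln_le_sub1 x : 0 < x -> ln x <= x - 1.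
Proof. by move=> x0; have := exp_ineq1_le (ln x); rewrite exp_ln //; lra. Qed.

Lemma ln_mono x y : 0 < x -> x <= y -> ln x <= ln y.
Proof. by move=> x0 [xy|->]; [left; apply: ln_increasing | right]. Qed.

Lemma ln_div x y : 0 < x -> 0 < y -> ln (x / y) = ln x - ln y.
Proof. by move=> x0 y0; have y1 := Rinv_0_lt_compat _ y0; rewrite /Rdiv ln_mult ?ln_Rinv. Qed.

(** Source of both submodularity and the cardinality bound: [ln x <= x - 1] is summed against [p],
    whose total mass 1 absorbs the constant. *)
Lemma gibbs (Omega : finType) (p G : Omega -> R) :
  (forall w, 0 <= p w) -> \big[Rplus/0]_w p w = 1 -> (forall w, 0 < G w) ->
  \big[Rplus/0]_w (p w * G w) <= 1 -> \big[Rplus/0]_w (p w * ln (G w)) <= 0.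
Proof.
move=> p0 p1 G0 hG.
apply: (Rle_trans _ (\big[Rplus/0]_w (p w * G w + - p w))).
  by apply: rsum_le => w _; have := ln_le_sub1 (G0 w); have := p0 w; nra.
by rewrite big_split rsumN /= p1; lra.
Qed.

Section Atoms.
Context {Omega M : finType}.
Implicit Types (p : Omega -> R) (xi : M -> Omega -> nat) (A B : {set M}).

Definition same xi A (w w' : Omega) : bool := [forall i in A, xi i w' == xi i w].

Lemma sameP xi A w w' : reflect (forall i, i \in A -> xi i w' = xi i w) (same xi A w w').
Proof.
apply: (iffP forall_inP) => h i iA; first by apply/eqP/h.
by apply/eqP/h.
Qed.

Lemma same_refl xi A w : same xi A w w.
Proof. exact/sameP. Qed.

Lemma same_sym xi A w w' : same xi A w w' = same xi A w' w.
Proof. by apply/sameP/sameP => h i iA; rewrite h. Qed.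

Lemma same_trans xi A w1 w2 w3 : same xi A w1 w2 -> same xi A w2 w3 -> same xi A w1 w3.
Proof. by move=> /sameP h1 /sameP h2; apply/sameP => i iA; rewrite h2 ?h1. Qed.

Lemma same_congr xi A w1 w2 w3 : same xi A w1 w2 -> same xi A w1 w3 = same xi A w2 w3.
Proof.
move=> h; apply/idP/idP; last exact: same_trans.
by apply: same_trans; rewrite same_sym.
Qed.

Lemma same_sub xi A B w w' : A \subset B -> same xi B w w' -> same xi A w w'.
Proof. by move=> /subsetP AB /sameP h; apply/sameP => i /AB; apply: h. Qed.

Lemma same_setU xi A B w w' : same xi (A :|: B) w w' = same xi A w w' && same xi B w w'.
Proof.
apply/sameP/andP => [h | [/sameP hA /sameP hB] i].
  by split; apply/sameP => i iA; apply: h; rewrite inE iA ?orbT.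
by rewrite inE => /orP[/hA|/hB].
Qed.

Lemma same_set0 xi w w' : same xi set0 w w'.
Proof. by apply/sameP => i; rewrite inE. Qed.

Lemma atomE p xi A w : atom_prob p xi A w = \big[Rplus/0]_(w' | same xi A w w') p w'.
Proof. by []. Qed.

Lemma atom_congr p xi A w w' : same xi A w w' -> atom_prob p xi A w = atom_prob p xi A w'.
Proof. by move=> h; rewrite !atomE; apply: eq_bigl => w2; exact: same_congr. Qed.

Lemma atom_ge p xi A w : (forall w, 0 <= p w) -> p w <= atom_prob p xi A w.
Proof. by move=> p0; rewrite atomE; apply: rsum_ge_term => //; exact: same_refl. Qed.

Lemma atom_gt0 p xi A w : (forall w, 0 < p w) -> 0 < atom_prob p xi A w.
Proof.
move=> p0; have := @atom_ge p xi A w (fun w => Rlt_le _ _ (p0 w)).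
by have := p0 w; lra.
Qed.

(** If nonempty, [Q] lies inside a single atom, so all denominators agree and the sum is the share
    of that atom covered by [Q]. *)
Lemma sum_atom_le1 p xi A (Q : pred Omega) :
  (forall w, 0 < p w) -> (forall w w', Q w -> Q w' -> same xi A w w') ->
  \big[Rplus/0]_(w | Q w) (p w / atom_prob p xi A w) <= 1.
Proof.
move=> p0 hQ; case: (pickP Q) => [w0 Q0 | Q0]; last by rewrite big_pred0 //; lra.
rewrite (eq_bigr (fun w => p w * / atom_prob p xi A w0)); last first.
  by move=> w Qw; rewrite (atom_congr p (hQ _ _ Qw Q0)).
rewrite rsum_mulr; have q0 := atom_gt0 xi A w0 p0.
apply: (Rmult_le_reg_r _ _ _ q0); rewrite Rmult_assoc Rinv_l; last by lra.
rewrite Rmult_1_l Rmult_1_r atomE; apply: rsum_le_subset => [w|w Qw]; first exact: Rlt_le.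
exact: hQ.
Qed.

End Atoms.

(** * Shannon inequalities *)

Definition positive_pmf (Omega : finType) (p : Omega -> R) :=
  (forall w, 0 < p w) /\ \big[Rplus/0]_w p w = 1.

(** Restricting to the support of [p] makes every atom probability positive, so that later
    logarithms and quotients need no case distinction. *)
Lemma entropic_positive (M : finType) (f : {set M} -> R) :
  entropic f <-> exists (Omega : finType) (p : Omega -> R) (xi : M -> Omega -> nat),
    positive_pmf p /\ (forall A, f A = entropy p xi A).
Proof.
split=> [[Omega [p [xi [p0 [p1 hf]]]]] | [Omega [p [xi [[p0 p1] hf]]]]]; last first.
  by exists Omega, p, xi; split=> // w; exact: Rlt_le.
pose pos : pred Omega := fun w => Rlt_dec 0 (p w).
have posP w : pos w -> 0 < p w by rewrite /pos; case: Rlt_dec.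
have posN w : ~~ pos w -> p w = 0.
  by rewrite /pos; case: Rlt_dec => //= h _; have := p0 w; lra.
have sumE (P : pred Omega) (F : Omega -> R) : (forall w, p w = 0 -> F w = 0) ->
    \big[Rplus/0]_(w | P w) F w =
    \big[Rplus/0]_(u : {w | w \in pos} | P (val u)) F (val u).
  move=> F0; rewrite big_mkcond [RHS]big_mkcond /=.
  rewrite -(big_sub pos (fun w => if P w then F w else 0)) [RHS]big_mkcond.
  apply: eq_bigr => w _; rewrite unfold_in -/(pos w).
  by case: (boolP (pos w)) => [//|/posN/F0 ->]; case: ifP.
pose p' (u : {w | w \in pos}) := p (val u).
exists {w | w \in pos}, p', (fun i u => xi i (val u)).
split; first by split; [move=> u; exact: posP (valP u) | rewrite -p1 (sumE predT)].
move=> A; rewrite hf /entropy (sumE predT); last by move=> w ->; rewrite Rmult_0_l.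
by congr (- _); apply: eq_bigr => u _; rewrite /atom_prob sumE.
Qed.

(** Finer atoms are smaller. The two families may have different index types, which allows comparing
    hashes with the variables they are computed from. *)
Lemma entropy_refine (Omega M M' : finType) (p : Omega -> R)
  (xi : M -> Omega -> nat) (xi' : M' -> Omega -> nat) A B : positive_pmf p ->
  (forall w w', same xi' B w w' -> same xi A w w') -> entropy p xi A <= entropy p xi' B.
Proof.
move=> [p0 _] h; apply: Ropp_le_contravar; apply: rsum_le => w _.
have p0' w' : 0 <= p w' by exact: Rlt_le.
apply: Rmult_le_compat_l => //; apply: ln_mono; first exact: atom_gt0.
by rewrite !atomE; apply: rsum_le_subset => // w'; exact: h.
Qed.

Section Shannon.
Context {Omega M : finType} (p : Omega -> R) (xi : M -> Omega -> nat).
Hypothesis (hp : positive_pmf p).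
Implicit Types A B : {set M}.

Let p0 w : 0 < p w. Proof. by case: hp. Qed.
Let p0' w : 0 <= p w. Proof. by have := p0 w; lra. Qed.
Let p1 : \big[Rplus/0]_w p w = 1. Proof. by case: hp. Qed.
Let q0 A w : 0 < atom_prob p xi A w. Proof. exact: atom_gt0. Qed.

Lemma entropy_set0 : entropy p xi set0 = 0.
Proof.
rewrite /entropy big1 ?Ropp_0 // => w _.
suff -> : atom_prob p xi set0 w = 1 by rewrite ln_1 Rmult_0_r.
by rewrite atomE -p1; apply: eq_bigl => w'; exact: same_set0.
Qed.

Lemma entropy_mono A B : A \subset B -> entropy p xi A <= entropy p xi B.
Proof. by move=> AB; apply: (entropy_refine hp) => w w'; exact: same_sub. Qed.

Lemma entropy_ge0 A : 0 <= entropy p xi A.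
Proof. by rewrite -entropy_set0; apply: entropy_mono; exact: sub0set. Qed.

(** [G] is the density, relative to the law of [A :|: B], of the law making [A] and [B]
    conditionally independent given [A :&: B]. Its expectation is at most 1, so [gibbs] applies. *)
Lemma entropy_submod A B :
  entropy p xi (A :|: B) + entropy p xi (A :&: B) <= entropy p xi A + entropy p xi B.
Proof.
pose q := atom_prob p xi.
pose G w := q A w * q B w / (q (A :|: B) w * q (A :&: B) w).
suff hG : \big[Rplus/0]_w (p w * ln (G w)) <= 0.
  have E : \big[Rplus/0]_w (p w * ln (G w)) =
     (\big[Rplus/0]_w (p w * ln (q A w)) + \big[Rplus/0]_w (p w * ln (q B w))) +
     (- (\big[Rplus/0]_w (p w * ln (q (A :|: B) w))) +
      - (\big[Rplus/0]_w (p w * ln (q (A :&: B) w)))).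
    rewrite -!rsumN -!big_split /=; apply: eq_bigr => w _.
    have h1 := q0 A w; have h2 := q0 B w.
    have h3 := q0 (A :|: B) w; have h4 := q0 (A :&: B) w.
    rewrite /G ln_div ?ln_mult //; [lra| exact: Rmult_lt_0_compat..].
  by move: hG; rewrite E /entropy /q; lra.
apply: gibbs => //.
  move=> w; rewrite /G.
  by apply: Rdiv_lt_0_compat; apply: Rmult_lt_0_compat; exact: q0.
(* Expand [q A w] and [q B w] as sums over [w1] and [w2]: the points [w] compatible
   with both lie in one [A :|: B]-atom, and exist only if [w1], [w2] agree on [A :&: B]. *)
pose Q w1 w2 w := same xi A w w1 && same xi B w w2.
have step w : p w * G w = \big[Rplus/0]_w1 \big[Rplus/0]_w2
   (if Q w1 w2 w then p w1 / q (A :&: B) w1 * p w2 * (p w / q (A :|: B) w) else 0).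
  have -> : p w * G w = p w / (q (A :|: B) w * q (A :&: B) w) * (q A w * q B w).
    by rewrite /G /Rdiv; ring.
  rewrite [q A w * _](big_distrlr _ _ _ _ _ p p) /= -rsum_mull big_mkcond.
  apply: eq_bigr => w1 _; rewrite -rsum_mull big_mkcond /= /Q -/(same xi A w w1).
  case: (boolP (same xi A w w1)) => h1; last by rewrite big1.
  apply: eq_bigr => w2 _; rewrite -/(same xi B w w2); case: (same xi B w w2) => //=.
  rewrite /q (atom_congr p (same_sub (subsetIl A B) h1)).
  have h3 := q0 (A :|: B) w; have h4 := q0 (A :&: B) w1.
  by field; lra.
rewrite (eq_bigr _ (fun w _ => step w)) exchange_big /=.
apply: (Rle_trans _ (\big[Rplus/0]_w1 \big[Rplus/0]_(w2 | same xi (A :&: B) w1 w2)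
    (p w1 / q (A :&: B) w1 * p w2))).
  apply: rsum_le => w1 _; rewrite exchange_big [X in _ <= X]big_mkcond /=.
  apply: rsum_le => w2 _; rewrite -big_mkcond /=.
  have h4 : 0 < p w1 / q (A :&: B) w1 by apply: Rdiv_lt_0_compat.
  case: ifPn => h.
    rewrite rsum_mull; have hw2 := p0 w2.
    have : \big[Rplus/0]_(w | Q w1 w2 w) (p w / q (A :|: B) w) <= 1.
      apply: sum_atom_le1 => // w w' /andP[a1 b1] /andP[a2 b2].
      rewrite same_setU (same_congr _ a1) (same_congr _ b1).
      by rewrite same_sym a2 same_sym b2.
    have : 0 < p w1 / q (A :&: B) w1 * p w2 by apply: Rmult_lt_0_compat.
    by nra.
  rewrite big_pred0; first by lra.
  move=> w; apply: contraNF h => /andP[a b].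
  by rewrite -(same_congr _ (same_sub (subsetIl A B) a)) (same_sub (subsetIr A B) b).
(* Summing [p w2] over the atom of [w1] cancels the denominator, and the masses [p w1] then add up
   to 1. *)
right; rewrite -p1; apply: eq_bigr => w1 _; rewrite rsum_mull -atomE.
by rewrite /q; have h4 := q0 (A :&: B) w1; field; lra.
Qed.

(** Comparison with the uniform law on [m] values through [gibbs]: each fibre of [c] lies in one
    atom and contributes at most 1. *)
Lemma entropy_ln_card (m : nat) (A : {set M}) (c : Omega -> 'I_m) :
  (forall w w', c w = c w' -> same xi A w w') -> entropy p xi A <= ln (INR m).
Proof.
move=> hc; case: (pickP (@predT Omega)) => [w0 _|e]; last first.
  by move: p1; rewrite big_pred0 //; lra.
have m0 : 0 < INR m by apply: lt_0_INR; apply/ltP; case: m c hc => // c; case: (c w0).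
pose G w := / (INR m * atom_prob p xi A w).
suff hG : \big[Rplus/0]_w (p w * ln (G w)) <= 0.
  move: hG; rewrite (eq_bigr (fun w => - ln (INR m) * p w + - (p w * ln (atom_prob p xi A w)))).
    by rewrite big_split /= rsum_mull rsumN p1 -/(entropy p xi A); lra.
  move=> w _; rewrite /G ln_Rinv ?ln_mult //; first by lra.
  exact: Rmult_lt_0_compat.
apply: gibbs => //; first by move=> w; apply: Rinv_0_lt_compat; exact: Rmult_lt_0_compat.
rewrite (eq_bigr (fun w => / INR m * (p w / atom_prob p xi A w))); last first.
  by move=> w _; have h := q0 A w; rewrite /G; field; lra.
rewrite rsum_mull (partition_big c predT) //=.
apply: (Rmult_le_reg_l (INR m)) => //; rewrite -Rmult_assoc Rinv_r ?Rmult_1_l ?Rmult_1_r; last by lra.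
apply: (Rle_trans _ (\big[Rplus/0]_(j < m) 1)); last by rewrite rsum_const card_ord; lra.
apply: rsum_le => j _; apply: sum_atom_le1 => // w w' /eqP e1 /eqP e2.
by apply: hc; rewrite e1.
Qed.

End Shannon.

Lemma entropic_polymatroid (M : finType) (f : {set M} -> R) : entropic f -> polymatroid f.
Proof.
move=> /entropic_positive[Omega [p [xi [hp hf]]]].
split; first by rewrite hf entropy_set0.
split; first by move=> A; rewrite hf; exact: entropy_ge0.
split; first by move=> A B AB; rewrite !hf; exact: entropy_mono.
by move=> A B; rewrite !hf; exact: entropy_submod.
Qed.

Lemma almost_entropic_polymatroid (M : finType) (f : {set M} -> R) :
  almost_entropic f -> polymatroid f.
Proof.
move=> hf.
have close eps : 0 < eps -> exists2 g, polymatroid g & forall A, Rabs (f A - g A) < eps.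
  by move=> /hf[g [/entropic_polymatroid hg h]]; exists g.
have le_eps x y : (forall eps, 0 < eps -> x <= y + eps) -> x <= y.
  by move=> h; apply: Rnot_lt_le => yx; have := h ((x - y) / 2); lra.
have bd g eps (h : forall A, Rabs (f A - g A) < eps) A : - eps < f A - g A < eps.
  by have := h A; move/Rabs_def2; lra.
split; [|split; [|split]].
- apply: Rle_antisym; apply: le_eps => e e0; have [g [g0 _] /bd/(_ set0)] := close _ e0; lra.
- move=> A; apply: le_eps => e e0; have [g [_ [g0 _]] /bd/(_ A)] := close _ e0.
  by have := g0 A; lra.
- move=> A B AB; apply: le_eps => e e0.
  have [|g [_ [_ [gm _]]] /bd h] := close (e / 2); first by lra.
  by have := gm _ _ AB; have := h A; have := h B; lra.
- move=> A B; apply: le_eps => e e0.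
  have [|g [_ [_ [_ gm]]] /bd h] := close (e / 4); first by lra.
  by have := gm A B; have := h A; have := h B; have := h (A :|: B); have := h (A :&: B); lra.
Qed.

Lemma almost_entropic_ext (M : finType) (f g : {set M} -> R) :
  f =1 g -> almost_entropic f -> almost_entropic g.
Proof. by move=> fg hf e /hf[h [eh hh]]; exists h; split=> // A; rewrite -fg. Qed.

Lemma polymatroid_subadd (M : finType) (f : {set M} -> R) (A B : {set M}) :
  polymatroid f -> f (A :|: B) <= f A + \big[Rplus/0]_(i in B) f [set i].
Proof.
move=> [_ [fge0 [_ sub]]]; move: {2}#|B| (erefl #|B|) => n.
elim: n B => [|n ih] B hB; first by rewrite (cards0_eq hB) setU0 big_set0; lra.
have [i iB] : exists i, i \in B by apply/set0Pn; rewrite -card_gt0 hB.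
have cB : #|B :\ i| = n by apply/eqP; rewrite -eqSS -hB (cardsD1 i B) iB.
have := ih _ cB; rewrite (big_setD1 i iB) /=.
have := sub (A :|: B :\ i) [set i]; rewrite -setUA [_ :\ i :|: _]setUC setD1K //.
have := fge0 ((A :|: B :\ i) :&: [set i]).
by lra.
Qed.

(** * The closed cone of almost entropic functions *)

Lemma rsum_pair (I J : finType) (F : I -> R) (G : J -> R) :
  \big[Rplus/0]_(w : I * J) (F w.1 * G w.2) = \big[Rplus/0]_i F i * \big[Rplus/0]_j G j.
Proof. by rewrite big_distrlr pair_big. Qed.

(** The variance of the information content. Being additive over independent copies, it makes the
    deviations of [N] copies of smaller order than [N]. *)
Definition varentropy (Omega M : finType) (p : Omega -> R) (xi : M -> Omega -> nat)
  (A : {set M}) : R :=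
  \big[Rplus/0]_w (p w * (- ln (atom_prob p xi A w) - entropy p xi A) ^ 2).

Section Product.
Context {Omega1 Omega2 M : finType}.
Context (p1 : Omega1 -> R) (p2 : Omega2 -> R).
Context (xi1 : M -> Omega1 -> nat) (xi2 : M -> Omega2 -> nat).
Hypotheses (hp1 : positive_pmf p1) (hp2 : positive_pmf p2).

Definition prod_pmf (w : Omega1 * Omega2) := p1 w.1 * p2 w.2.
(** Variables take values in [nat], so a pair of values is coded by [pickle]; injectivity of the
    code makes atoms products of atoms. *)
Definition prod_rv (i : M) (w : Omega1 * Omega2) : nat := pickle (xi1 i w.1, xi2 i w.2).

Lemma prod_pmf_positive : positive_pmf prod_pmf.
Proof.
case: hp1 hp2 => [a1 b1] [a2 b2]; split=> [w|]; first exact: Rmult_lt_0_compat.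
by rewrite rsum_pair b1 b2; lra.
Qed.

Lemma atom_prod A w :
  atom_prob prod_pmf prod_rv A w = atom_prob p1 xi1 A w.1 * atom_prob p2 xi2 A w.2.
Proof.
rewrite !atomE big_distrlr pair_big /=; apply: eq_bigl => w'.
apply/sameP/andP => [h | [/sameP h1 /sameP h2] i iA]; last by rewrite /prod_rv h1 ?h2.
by split; apply/sameP => i /h /(pcan_inj pickleK)[].
Qed.

Let s1 A w := - ln (atom_prob p1 xi1 A w).
Let s2 A w := - ln (atom_prob p2 xi2 A w).

Let ln_atom_prod A w : - ln (atom_prob prod_pmf prod_rv A w) = s1 A w.1 + s2 A w.2.
Proof.
rewrite atom_prod ln_mult /s1 /s2; first by lra.
- exact: atom_gt0 hp1.1.
- exact: atom_gt0 hp2.1.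
Qed.

Let entropyE (Omega : finType) (p : Omega -> R) (xi : M -> Omega -> nat) A :
  entropy p xi A = \big[Rplus/0]_w (p w * - ln (atom_prob p xi A w)).
Proof. by rewrite /entropy -rsumN; apply: eq_bigr => w _; lra. Qed.

Lemma entropy_prod A :
  entropy prod_pmf prod_rv A = entropy p1 xi1 A + entropy p2 xi2 A.
Proof.
rewrite entropyE (eq_bigr (fun w => (p1 w.1 * s1 A w.1) * p2 w.2 + p1 w.1 * (p2 w.2 * s2 A w.2))).
  rewrite big_split /= (rsum_pair (fun w => p1 w * s1 A w)) (rsum_pair p1 (fun w => p2 w * s2 A w)).
  by rewrite hp1.2 hp2.2 !entropyE /s1 /s2; lra.
by move=> w _; rewrite ln_atom_prod /prod_pmf; lra.
Qed.

Lemma varentropy_prod A :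
  varentropy prod_pmf prod_rv A = varentropy p1 xi1 A + varentropy p2 xi2 A.
Proof.
pose d1 w := s1 A w - entropy p1 xi1 A; pose d2 w := s2 A w - entropy p2 xi2 A.
(* The centred information content has mean zero, which kills the cross term of the square. *)
have z1 : \big[Rplus/0]_w (p1 w * d1 w) = 0.
  rewrite (eq_bigr (fun w => p1 w * s1 A w + p1 w * - entropy p1 xi1 A)); last first.
    by move=> w _; rewrite /d1; lra.
  by rewrite big_split /= rsum_mulr hp1.2 /s1 -entropyE; lra.
rewrite /varentropy (eq_bigr (fun w => (p1 w.1 * d1 w.1 ^ 2) * p2 w.2 +
  (2 * ((p1 w.1 * d1 w.1) * (p2 w.2 * d2 w.2)) + p1 w.1 * (p2 w.2 * d2 w.2 ^ 2)))).
  rewrite !big_split rsum_mull /= (rsum_pair (fun w => p1 w * (d1 w * (d1 w * 1)))).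
  rewrite (rsum_pair (fun w => p1 w * d1 w) (fun w => p2 w * d2 w)) z1.
  rewrite (rsum_pair p1 (fun w => p2 w * (d2 w * (d2 w * 1)))) hp1.2 hp2.2.
  by rewrite /d1 /d2 /s1 /s2; lra.
by move=> w _; rewrite ln_atom_prod entropy_prod /prod_pmf /d1 /d2; ring.
Qed.

End Product.

Lemma iid_copies (Omega M : finType) (p : Omega -> R) (xi : M -> Omega -> nat) (N : nat) :
  positive_pmf p ->
  exists (Omega' : finType) (p' : Omega' -> R) (xi' : M -> Omega' -> nat),
    [/\ positive_pmf p', forall A, entropy p' xi' A = INR N * entropy p xi A &
        forall A, varentropy p' xi' A = INR N * varentropy p xi A].
Proof.
move=> hp; elim: N => [|N [Omega' [p' [xi' [hp' he hv]]]]].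
  have hq : positive_pmf (fun _ : unit => 1).
    by split=> [_|]; [lra | rewrite rsum_const card_unit /=; lra].
  have at1 A w : atom_prob (fun _ : unit => 1) (fun (_ : M) _ => O) A w = 1.
    rewrite atomE (eq_bigl predT) => [|[]]; first exact: hq.2.
    by case: w; exact: same_refl.
  have e0 A : entropy (fun _ : unit => 1) (fun (_ : M) _ => O) A = 0.
    by rewrite /entropy big1 ?Ropp_0 // => w _; rewrite at1 ln_1; lra.
  exists unit, (fun _ => 1), (fun _ _ => O).
  split=> // A; first by rewrite e0 /=; lra.
  rewrite /varentropy big1 /=; first by lra.
  by move=> w _; rewrite at1 ln_1 e0; lra.
exists (Omega * Omega')%type, (prod_pmf p p'), (prod_rv xi xi').
split=> [|A|A]; first exact: prod_pmf_positive.
  by rewrite entropy_prod // he S_INR; lra.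
by rewrite varentropy_prod // hv S_INR; lra.
Qed.

Lemma entropic_add (M : finType) (f g : {set M} -> R) :
  entropic f -> entropic g -> entropic (fun A => f A + g A).
Proof.
move=> /entropic_positive[O1 [p1 [xi1 [h1 e1]]]] /entropic_positive[O2 [p2 [xi2 [h2 e2]]]].
apply/entropic_positive; exists (O1 * O2)%type, (prod_pmf p1 p2), (prod_rv xi1 xi2).
by split; [exact: prod_pmf_positive | move=> A; rewrite e1 e2 entropy_prod].
Qed.

Lemma entropic_mul_nat (M : finType) (f : {set M} -> R) (n : nat) :
  entropic f -> entropic (fun A => INR n * f A).
Proof.
move=> /entropic_positive[Om [p [xi [h e]]]].
have [Om' [p' [xi' [h' e' _]]]] := iid_copies xi n h.
by apply/entropic_positive; exists Om', p', xi'; split=> // A; rewrite e e'.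
Qed.

Lemma entropic0 (M : finType) : entropic (fun _ : {set M} => 0).
Proof.
have hq : positive_pmf (fun _ : unit => 1).
  by split=> [_|]; [lra | rewrite rsum_const card_unit /=; lra].
have [Om [p [xi [h e _]]]] := iid_copies (fun (_ : M) (_ : unit) => O) 0 hq.
by apply/entropic_positive; exists Om, p, xi; split=> // A; rewrite e /=; lra.
Qed.

(** From [- ln x = 2 * ln (/ sqrt x)] and [ln y <= y - 1]; what matters is an explicit bound tending
    to 0 with [x]. *)
Lemma binary_entropy_le x : 0 < x < 1 -> - (x * ln x) - (1 - x) * ln (1 - x) <= 2 * sqrt x + x.
Proof.
move=> [x0 x1].
have s0 := sqrt_lt_R0 _ x0; have ss := sqrt_sqrt x (Rlt_le _ _ x0).
have l1 : - ln x <= 2 * / sqrt x.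
  have := ln_le_sub1 (Rinv_0_lt_compat _ s0); rewrite ln_Rinv //.
  by rewrite -{3}ss ln_mult //; lra.
have l2 : - ln (1 - x) <= / (1 - x) - 1.
  have h : 0 < 1 - x by lra.
  by have := ln_le_sub1 (Rinv_0_lt_compat _ h); rewrite ln_Rinv.
have e1 : x * (2 * / sqrt x) = 2 * sqrt x by rewrite -{1}ss; field; lra.
have e2 : (1 - x) * (/ (1 - x) - 1) = x by field; lra.
have : x * - ln x <= x * (2 * / sqrt x) by apply: Rmult_le_compat_l; lra.
have : (1 - x) * - ln (1 - x) <= (1 - x) * (/ (1 - x) - 1) by apply: Rmult_le_compat_l; lra.
by lra.
Qed.

(* Erasing all variables together with probability [1 - x]. *)
Lemma entropic_thin (M : finType) (f : {set M} -> R) (x : R) :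
  entropic f -> 0 < x < 1 ->
  exists2 g, entropic g & forall A, x * f A <= g A <= x * f A + (2 * sqrt x + x).
Proof.
move=> /entropic_positive[Om [p [xi [[p0 p1] e]]]] hx.
pose p' (w : unit + Om) := if w is inr w then x * p w else 1 - x.
(* The successor reserves the value 0 for erasure, so that any single variable reveals whether
   erasure took place. *)
pose xi' (i : M) (w : unit + Om) := if w is inr w then (xi i w).+1 else 0%nat.
have hp' : positive_pmf p'.
  split=> [[w|w] /=|]; [lra | by apply: Rmult_lt_0_compat; [lra|] |].
  by rewrite big_sumType /= rsum_mull p1 rsum_const card_unit /=; lra.
exists (entropy p' xi'); first by apply/entropic_positive; exists (unit + Om)%type, p', xi'.
have b0 : 0 <= - (x * ln x) - (1 - x) * ln (1 - x).
  by have := @ln_le_sub1 x; have := @ln_le_sub1 (1 - x); nra.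
have b1 := binary_entropy_le hx.
move=> A; rewrite e; have [->|/set0Pn[i iA]] := eqVneq A set0.
  by rewrite !entropy_set0 //; have := sqrt_pos x; lra.
have same_lr w w' : same xi' A (inl w) (inr w') = false.
  by apply/sameP => /(_ i iA).
have same_rl w w' : same xi' A (inr w) (inl w') = false.
  by apply/sameP => /(_ i iA).
have same_rr w w' : same xi' A (inr w) (inr w') = same xi A w w'.
  by apply/sameP/sameP => h j jA; [have [] := h j jA | rewrite /= h].
have at_l w : atom_prob p' xi' A (inl w) = 1 - x.
  rewrite atomE big_sumType /= [X in _ + X]big_pred0 => [|w']; last exact: same_lr.
  rewrite (eq_bigl predT) ?rsum_const ?card_unit /=; first by lra.
  by move=> []; case: w; exact: same_refl.
have at_r w : atom_prob p' xi' A (inr w) = x * atom_prob p xi A w.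
  rewrite atomE big_sumType /= big_pred0 => [|w']; last exact: same_rl.
  by rewrite (eq_bigl _ _ (same_rr w)) rsum_mull Rplus_0_l.
suff -> : entropy p' xi' A = x * entropy p xi A + (- (x * ln x) - (1 - x) * ln (1 - x)) by lra.
rewrite /entropy big_sumType /= (eq_bigr (fun=> (1 - x) * ln (1 - x))); last first.
  by move=> w _; rewrite at_l.
rewrite rsum_const card_unit (eq_bigr (fun w => x * ln x * p w + x * (p w * ln (atom_prob p xi A w)))).
  by rewrite big_split /= !rsum_mull p1; lra.
by move=> w _; rewrite at_r ln_mult; [lra|lra|exact: atom_gt0].
Qed.

Lemma almost_entropic_add (M : finType) (f g : {set M} -> R) :
  almost_entropic f -> almost_entropic g -> almost_entropic (fun A => f A + g A).
Proof.
move=> hf hg e e0.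
have [|f' [ef hf']] := hf (e / 2); first by lra.
have [|g' [eg hg']] := hg (e / 2); first by lra.
exists (fun A => f' A + g' A); split; first exact: entropic_add.
move=> A; have /Rabs_def2 a := hf' A; have /Rabs_def2 b := hg' A.
by apply: Rabs_def1; lra.
Qed.

(** For positive [c], take [k] independent copies and keep them with probability [x = c / k]. The
    mean factor is [c], and the entropy of the erasure event vanishes as [k] grows. *)
Lemma almost_entropic_scale (M : finType) (f : {set M} -> R) (c : R) :
  almost_entropic f -> 0 <= c -> almost_entropic (fun A => c * f A).
Proof.
move=> hf [c0 e e0|<- e e0]; last first.
  exists (fun=> 0); split; first exact: entropic0.
  by move=> A; apply: Rabs_def1; lra.
have [|g [eg hg]] := hf (e / (2 * c)); first by apply: Rdiv_lt_0_compat; lra.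
(* The bound [1 / 2] ensures [x < 1]; the bound [e / 8] keeps the erasure error
   [2 * sqrt x + x <= 2 * d + d * d] below [e / 2]. *)
pose d := Rmin (e / 8) (1 / 2).
have [d1 d2] : d <= e / 8 /\ d <= 1 / 2 by split; [exact: Rmin_l | exact: Rmin_r].
have d0 : 0 < d by apply: Rmin_pos; lra.
have [k hk] := INR_unbounded (c / (d * d)).
have dd : 0 < d * d by nra.
have k0 : 0 < INR k by have := Rdiv_lt_0_compat _ _ c0 dd; lra.
pose x := c / INR k.
have x0 : 0 < x by exact: Rdiv_lt_0_compat.
have xd : x <= d * d.
  have : c < INR k * (d * d).
    have -> : c = c / (d * d) * (d * d) by field; lra.
    by apply: Rmult_lt_compat_r; lra.
  have -> : c = x * INR k by rewrite /x; field; lra.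
  by nra.
have sx : sqrt x <= d.
  by rewrite -(sqrt_square d); [apply: sqrt_le_1; lra | lra].
have [|h eh hh] := entropic_thin (x := x) (entropic_mul_nat k eg); first by nra.
exists h; split=> // A; have := hh A; have /Rabs_def2 := hg A.
have -> : x * (INR k * g A) = c * g A by rewrite /x; field; lra.
move=> [u v].
have ec : c * (e / (2 * c)) = e / 2 by field; lra.
have := Rmult_lt_compat_l _ _ _ c0 u; have := Rmult_lt_compat_l _ _ _ c0 v.
by move=> *; apply: Rabs_def1; nra.
Qed.

(** * Random hashing *)

Lemma rprod_const_if (I : finType) (P : pred I) (c : R) :
  \big[Rmult/1]_i (if P i then c else 1) = c ^ #|P|.
Proof.
rewrite -big_mkcond big_const; elim: #|P| => //= n ->.
by [].
Qed.

Lemma sum_ffun_prod (I J : finType) (F : I -> J -> R) :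
  \big[Rplus/0]_(h : {ffun I -> J}) \big[Rmult/1]_i F i (h i) =
  \big[Rmult/1]_i \big[Rplus/0]_j F i j.
Proof. by rewrite bigA_distr_bigA. Qed.

(** A uniformly random function identifies two distinct points with probability [/ m]. Splitting by
    the common value [c] turns the indicator into a product over points, so the sum over functions
    factors. *)
Lemma collision_count (Omega : finType) (m : nat) (x y : Omega) : x != y ->
  INR m * \big[Rplus/0]_(k : {ffun Omega -> 'I_m}) (if k x == k y then 1 else 0) =
  \big[Rplus/0]_(k : {ffun Omega -> 'I_m}) 1.
Proof.
move=> xy.
pose g (c : 'I_m) z (v : 'I_m) := if (z == x) || (z == y) then (if v == c then 1 else 0) else 1.
have sg c z : \big[Rplus/0]_v g c z v = if (z == x) || (z == y) then 1 else INR m.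
  rewrite /g; case: ifP => _; last by rewrite rsum_const card_ord; lra.
  by rewrite -big_mkcond big_pred1_eq.
have -> : \big[Rplus/0]_(k : {ffun Omega -> 'I_m}) (if k x == k y then 1 else 0) =
    \big[Rplus/0]_(c < m) \big[Rplus/0]_(k : {ffun Omega -> 'I_m}) \big[Rmult/1]_z g c z (k z).
  rewrite exchange_big; apply: eq_bigr => k _.
  rewrite (eq_bigr (fun c => if c == k x then (if k x == k y then 1 else 0) else 0)).
    by rewrite -big_mkcond big_pred1_eq.
  move=> c _; rewrite (bigD1 x) // (bigD1 y) 1?eq_sym //= /g !eqxx orbT /=.
  rewrite big1 => [|z /andP[/negPf -> /negPf ->] //].
  case: (eqVneq (k x) c) => [->|_]; last by lra.
  by rewrite [c == k y]eq_sym; case: ifP => _; lra.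
have -> : \big[Rplus/0]_(k : {ffun Omega -> 'I_m}) 1 =
    \big[Rplus/0]_(k : {ffun Omega -> 'I_m}) \big[Rmult/1]_(z : Omega) 1.
  by apply: eq_bigr => k _; rewrite big1.
rewrite (sum_ffun_prod (fun _ _ => 1)).
rewrite [X in INR m * X](eq_bigr (fun=> \big[Rmult/1]_(z | (z != x) && (z != y)) INR m)).
  rewrite rsum_const card_ord [RHS](bigD1 x) // [X in _ = _ * X](bigD1 y) 1?eq_sym //=.
  rewrite !rsum_const !card_ord !Rmult_1_r; congr (_ * (_ * _)).
move=> c _; rewrite sum_ffun_prod (bigD1 x) // (bigD1 y) 1?eq_sym //= !sg !eqxx orbT.
rewrite !Rmult_1_l; apply: eq_bigr => z /andP[zx zy].
by rewrite sg (negPf zx) (negPf zy).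
Qed.

Lemma exists_le_average (I : finType) (F : I -> R) (c : R) :
  (0 < #|I|)%nat -> \big[Rplus/0]_i F i <= INR #|I| * c -> exists i, F i <= c.
Proof.
move=> I0 h; case: (pickP (fun i => is_left (Rle_dec (F i) c))) => [i|hi].
  by case: Rle_dec => // ? _; exists i.
have gt i : c < F i by have := hi i; case: Rle_dec => //= ? _; lra.
have /card_gt0P[i0 _] := I0.
suff : INR #|I| * c < \big[Rplus/0]_i F i by lra.
rewrite -rsum_const (bigD1 i0) // [X in _ < X](bigD1 i0) //=.
apply: Rplus_lt_le_compat => //; apply: rsum_le => i _; exact: Rlt_le.
Qed.

Section Hashing.
Context {Omega M E : finType} (p : Omega -> R) (xi : M -> Omega -> nat).
Context (phi : E -> {set M}) (m : nat).
Hypotheses (hp : positive_pmf p) (m0 : (0 < m)%nat).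

(** Counts the hashes of [J] that [xi] on [K] does not determine; each of them adds at most [ln m]
    to the entropy. *)
Definition hash_cost (J : {set E}) (K : {set M}) : nat :=
  #|[set e in J | ~~ (phi e \subset K)]|.

Local Notation hashes := {ffun E -> {ffun Omega -> 'I_m}}.

(** A canonical point of the atom of [w], so that a hash of it is a function of [xi] on [U]. The
    default is never reached, as [w] lies in its own atom. *)
Let rep (U : {set M}) (w : Omega) : Omega := odflt w [pick w' | same xi U w w'].

Let rep_eq U w w' : (rep U w == rep U w') = same xi U w w'.
Proof.
have hr v : same xi U v (rep U v).
  by rewrite /rep; case: pickP => //= _; exact: same_refl.
apply/eqP/idP => [e | h].
  by apply: same_trans (hr w) _; rewrite e same_sym.
rewrite /rep (eq_pick (fun v => same_congr v h)).
case: pickP => //= /(_ w'); by rewrite same_refl.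
Qed.

Definition hash_rv (h : hashes) (e : E) (w : Omega) : nat := h e (rep (phi e) w).

Let Hn := INR #|hashes|.
Let rm := INR m.

Let rm0 : 0 < rm. Proof. by apply: lt_0_INR; apply/ltP. Qed.
Let hashes0 : (0 < #|hashes|)%nat.
Proof. by rewrite !card_ffun card_ord !expn_gt0 m0. Qed.
Let Hn0 : 0 < Hn. Proof. by apply: lt_0_INR; apply/ltP. Qed.

(** Hashes whose inputs agree at [w] and [w'] always collide; the others collide independently, each
    with probability [/ m]. *)
Let count_same J w w' :
  \big[Rplus/0]_(h : hashes) (if same (hash_rv h) J w w' then 1 else 0) =
  Hn * (/ rm) ^ #|[set e in J | ~~ same xi (phi e) w w']|.
Proof.
pose G e (k : {ffun Omega -> 'I_m}) :=
  if (e \in J) && (k (rep (phi e) w') != k (rep (phi e) w)) then 0 else 1.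
rewrite (eq_bigr (fun h : hashes => \big[Rmult/1]_e G e (h e))); last first.
  move=> h _; case: sameP => [hs|hs].
    rewrite big1 // => e _; rewrite /G; case: (boolP (e \in J)) => //= eJ.
    by have /val_inj -> := hs e eJ; rewrite eqxx.
  have [e eJ ne] : exists2 e, e \in J & hash_rv h e w' != hash_rv h e w.
    have /forall_inPn[e eJ ne] : ~~ [forall e in J, hash_rv h e w' == hash_rv h e w].
      by apply/negP => /forall_inP hh; apply: hs => e /hh/eqP.
    by exists e.
  rewrite (bigD1 e) //= /G eJ /=; have -> : h e (rep (phi e) w') != h e (rep (phi e) w).
    by apply: contraNneq ne => ee; rewrite /hash_rv ee.
  by rewrite Rmult_0_l.
rewrite sum_ffun_prod.
pose n := \big[Rplus/0]_(k : {ffun Omega -> 'I_m}) 1.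
rewrite (eq_bigr (fun e => n * (if (e \in J) && ~~ same xi (phi e) w w' then / rm else 1))).
  rewrite big_split /= rprod_const_if; congr (_ * _).
    have <- : \big[Rplus/0]_(h : hashes) 1 = Hn by rewrite rsum_const Rmult_1_r.
    rewrite (eq_bigr (fun h : hashes => \big[Rmult/1]_(e : E) 1)).
      by rewrite (sum_ffun_prod (fun _ _ => 1)).
    by move=> h _; rewrite big1.
  by congr (_ ^ _); apply: eq_card => e; rewrite !inE.
move=> e _; rewrite /G; case: (e \in J) => /=; last by rewrite -/n; lra.
case: (boolP (same xi (phi e) w w')) => /= hs.
  rewrite (eq_bigr (fun=> 1)) => [|k _]; first by rewrite -/n; lra.
  have /eqP -> : rep (phi e) w' == rep (phi e) w by rewrite rep_eq same_sym.
  by rewrite eqxx.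
rewrite /n -(@collision_count Omega m (rep (phi e) w') (rep (phi e) w)); last first.
  by rewrite rep_eq same_sym.
rewrite [rm * _]Rmult_comm Rmult_assoc Rinv_r ?Rmult_1_r; last by lra.
by apply: eq_bigr => k _; case: eqP.
Qed.

(** Each [w'] is charged to the set [K] of all variables on which it agrees with [w], for which
    [hash_cost] counts exactly the hashes with differing inputs. Summing over all [K] can only
    overcount. *)
Let sum_atom_hash J w :
  \big[Rplus/0]_(h : hashes) atom_prob p (hash_rv h) J w <=
  Hn * \big[Rplus/0]_(K : {set M}) ((/ rm) ^ hash_cost J K * atom_prob p xi K w).
Proof.
have irm0 : 0 < / rm by exact: Rinv_0_lt_compat.
have pw0 w' : 0 < p w' by case: hp.
rewrite (eq_bigr (fun h : hashes =>
   \big[Rplus/0]_w' (p w' * (if same (hash_rv h) J w w' then 1 else 0)))); last first.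
  by move=> h _; rewrite atomE big_mkcond; apply: eq_bigr => w' _; case: ifP => _; lra.
rewrite exchange_big /=.
have -> : \big[Rplus/0]_(K : {set M}) ((/ rm) ^ hash_cost J K * atom_prob p xi K w) =
    \big[Rplus/0]_w' \big[Rplus/0]_(K : {set M})
       (if same xi K w w' then (/ rm) ^ hash_cost J K * p w' else 0).
  rewrite exchange_big /=; apply: eq_bigr => K _.
  by rewrite atomE -rsum_mull big_mkcond.
rewrite -rsum_mull; apply: rsum_le => w' _.
rewrite rsum_mull count_same.
pose K := [set i | xi i w' == xi i w].
have sK : same xi K w w' by apply/sameP => i; rewrite inE => /eqP.
have -> : #|[set e in J | ~~ same xi (phi e) w w']| = hash_cost J K.
  apply: eq_card => e; rewrite !inE; congr (_ && ~~ _).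
  apply/sameP/subsetP => hs i ie; first by rewrite inE hs.
  by have := hs i ie; rewrite inE => /eqP.
have -> : p w' * (Hn * (/ rm) ^ hash_cost J K) = Hn * ((/ rm) ^ hash_cost J K * p w') by ring.
apply: Rmult_le_compat_l; first exact: Rlt_le.
have := @rsum_ge_term _ predT
  (fun K => if same xi K w w' then (/ rm) ^ hash_cost J K * p w' else 0) K.
rewrite sK; apply=> // K'; case: ifP => _; last by lra.
by apply: Rmult_le_pos; [apply: pow_le; lra | exact: Rlt_le].
Qed.

Let info K w := - ln (atom_prob p xi K w).
Let dev w := \big[Rplus/0]_(K : {set M}) Rabs (info K w - entropy p xi K).

(* Jensen's inequality for the concave logarithm, averaged over the hash functions. *)
Let sum_entropy_hash_ge J (r : R) :
  (forall K, r <= entropy p xi K + INR (hash_cost J K) * ln rm) ->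
  Hn * (r - ln (INR #|{set M}|) - \big[Rplus/0]_w (p w * dev w)) <=
  \big[Rplus/0]_(h : hashes) entropy p (hash_rv h) J.
Proof.
move=> hr.
have pw0 w' : 0 < p w' by case: hp.
have T0 : 0 < INR #|{set M}| by apply: lt_0_INR; apply/ltP; apply/card_gt0P; exists set0.
have pt w : \big[Rplus/0]_(h : hashes) ln (atom_prob p (hash_rv h) J w) <=
    Hn * (ln (INR #|{set M}|) - r + dev w).
  (* Bound on the average atom probability: every [K] contributes at most [exp (- (r - dev w))],
     because its information content differs from its entropy by at most [dev w]. *)
  pose b := INR #|{set M}| * exp (- (r - dev w)).
  have b0 : 0 < b by apply: Rmult_lt_0_compat => //; exact: exp_pos.
  have lb : ln b = ln (INR #|{set M}|) - r + dev w.
    by rewrite /b ln_mult ?ln_exp //; [lra | exact: exp_pos].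
  have hb : \big[Rplus/0]_(h : hashes) atom_prob p (hash_rv h) J w <= Hn * b.
    apply: Rle_trans (sum_atom_hash J w) _; apply: Rmult_le_compat_l; first exact: Rlt_le.
    rewrite /b -rsum_const; apply: rsum_le => K _.
    have a0 := atom_gt0 xi K w pw0.
    have -> : (/ rm) ^ hash_cost J K * atom_prob p xi K w =
        exp (- (INR (hash_cost J K) * ln rm) - info K w).
      rewrite /info /Rminus Ropp_involutive exp_plus exp_ln //; congr (_ * _).
      by rewrite Ropp_mult_distr_r -ln_Rinv // -/(Rpower _ _) Rpower_pow //;
         exact: Rinv_0_lt_compat.
    have dK : Rabs (info K w - entropy p xi K) <= dev w.
      apply: (@rsum_ge_term _ predT (fun K => Rabs (info K w - entropy p xi K))) => // K'.
      exact: Rabs_pos.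
    have := hr K; have := Rle_abs (- (info K w - entropy p xi K)).
    rewrite Rabs_Ropp => h1 h2.
    have : - (INR (hash_cost J K) * ln rm) - info K w <= - (r - dev w) by lra.
    by case=> [/exp_increasing|->]; [exact: Rlt_le | right].
  (* The tangent of the logarithm at [b] gives Jensen's inequality with no convexity theory. *)
  rewrite -lb; apply: (Rle_trans _ (\big[Rplus/0]_(h : hashes)
      (ln b - 1 + / b * atom_prob p (hash_rv h) J w))).
    apply: rsum_le => h _; have a0 := atom_gt0 (hash_rv h) J w pw0.
    have := ln_le_sub1 (Rdiv_lt_0_compat _ _ a0 b0); rewrite ln_div // /Rdiv; lra.
  rewrite big_split /= rsum_mull rsum_const -/Hn.
  have : / b * \big[Rplus/0]_(h : hashes) atom_prob p (hash_rv h) J w <= / b * (Hn * b).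
    by apply: Rmult_le_compat_l => //; apply: Rlt_le; exact: Rinv_0_lt_compat.
  have -> : / b * (Hn * b) = Hn by field; lra.
  by move=> /(Rplus_le_compat_l (Hn * (ln b - 1))) hle; apply: Rle_trans hle _; lra.
rewrite (rsumN predT) exchange_big /=.
rewrite [X in _ <= - X](eq_bigr (fun w =>
    p w * \big[Rplus/0]_(h : hashes) ln (atom_prob p (hash_rv h) J w)));
  last by move=> w _; rewrite rsum_mull.
have : \big[Rplus/0]_w (p w * \big[Rplus/0]_(h : hashes) ln (atom_prob p (hash_rv h) J w)) <=
   \big[Rplus/0]_w (Hn * (ln (INR #|{set M}|) - r) * p w + Hn * (p w * dev w)).
  apply: rsum_le => w _; have := Rmult_le_compat_l _ _ _ (Rlt_le _ _ (pw0 w)) (pt w); lra.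
by rewrite big_split /= !rsum_mull hp.2; lra.
Qed.

(** The hashes of [J] are functions of [xi] on [K] together with the hashes not determined by it.
    The family [zeta] puts both kinds of variables on one space, where subadditivity applies. *)
Let entropy_hash_le (h : hashes) J K :
  entropy p (hash_rv h) J <= entropy p xi K + INR (hash_cost J K) * ln rm.
Proof.
pose zeta (x : M + E) := match x with inl i => xi i | inr e => hash_rv h e end.
pose A : {set M + E} := inl @: K.
pose B : {set M + E} := inr @: [set e in J | ~~ (phi e \subset K)].
have cB : #|B| = hash_cost J K by rewrite card_imset // => e e' [].
have hz : polymatroid (entropy p zeta).
  by apply: entropic_polymatroid; apply/entropic_positive; exists Omega, p, zeta.
apply: (Rle_trans _ (entropy p zeta (A :|: B))).
  apply: entropy_refine => // w w' /sameP hs; apply/sameP => e eJ.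
  case: (boolP (phi e \subset K)) => hK; last first.
    by apply: (hs (inr e)); rewrite inE imset_f ?orbT // inE eJ.
  rewrite /hash_rv; have /eqP -> // : rep (phi e) w' == rep (phi e) w.
  rewrite rep_eq same_sym; apply/sameP => i /(subsetP hK) iK.
  by apply: (hs (inl i)); rewrite inE imset_f.
rewrite -cB -rsum_const; apply: Rle_trans (polymatroid_subadd A B hz) _.
apply: Rplus_le_compat; last first.
  apply: rsum_le => x /imsetP[e _ ->]; apply: (entropy_ln_card hp (c := fun w => h e (rep (phi e) w))).
  move=> w w' e'; apply/sameP => y; rewrite inE => /eqP ->.
  by rewrite /= /hash_rv e'.
apply: entropy_refine => // w w' /sameP hs.
by apply/sameP => x /imsetP[i iK ->]; exact: hs.
Qed.

(** The upper bound holds for every hash. Hence all deficits are non-negative, and a hash whose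
    total deficit over all [J] is at most average has every single deficit below that average. *)
Lemma hashing (r u : {set E} -> R) :
  (forall J K, r J <= entropy p xi K + INR (hash_cost J K) * ln (INR m)) ->
  (forall J, exists K, entropy p xi K + INR (hash_cost J K) * ln (INR m) <= u J) ->
  exists g, entropic g /\ forall J, u J - \big[Rplus/0]_(J : {set E}) (u J - r J + ln (INR #|{set M}|) +
      \big[Rplus/0]_(K : {set M}) \big[Rplus/0]_w (p w * Rabs (info K w - entropy p xi K)))
    <= g J <= u J.
Proof.
move=> hr hu; set c := \big[Rplus/0]_(J : {set E}) _.
have up h J : entropy p (hash_rv h) J <= u J.
  by have [K hK] := hu J; exact: Rle_trans (entropy_hash_le h J K) hK.
have [|h hh] := @exists_le_average hashes
    (fun h => \big[Rplus/0]_(J : {set E}) (u J - entropy p (hash_rv h) J)) c hashes0.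
  rewrite exchange_big /= -/Hn /c -rsum_mull; apply: rsum_le => J _.
  rewrite big_split rsumN /= rsum_const -/Hn; have := sum_entropy_hash_ge (hr J).
  have -> : \big[Rplus/0]_w (p w * dev w) =
      \big[Rplus/0]_(K : {set M}) \big[Rplus/0]_w (p w * Rabs (info K w - entropy p xi K)).
    by rewrite exchange_big /=; apply: eq_bigr => w _; rewrite rsum_mull.
  set D := \big[Rplus/0]_(K : {set M}) _; set S := \big[Rplus/0]_(h : hashes) _ => hS.
  apply: (Rle_trans _ (Hn * u J - Hn * (r J - ln (INR #|{set M}|) - D))); last by right; ring.
  by apply: Rplus_le_compat_l; apply: Ropp_le_contravar; exact: hS.
exists (entropy p (hash_rv h)); split.
  by apply/entropic_positive; exists Omega, p, (hash_rv h).
move=> J; split=> //.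
have : u J - entropy p (hash_rv h) J <= c; last by lra.
apply: Rle_trans hh; apply: (@rsum_ge_term _ predT (fun J => u J - entropy p (hash_rv h) J)) => //.
by move=> J'; have := up h J'; lra.
Qed.

End Hashing.

Lemma INR_expn2 n : INR (expn 2 n) = 2 ^ n.
Proof. by elim: n => [//|n ih]; rewrite expnS mult_INR ih. Qed.

(** Pointwise [2 * lam * |d| <= d ^ 2 + lam ^ 2]; the free parameter [lam] replaces the square root
    of Cauchy-Schwarz. *)
Lemma mean_deviation_le (Omega M : finType) (p : Omega -> R) (xi : M -> Omega -> nat) A lam :
  positive_pmf p -> 0 < lam ->
  \big[Rplus/0]_w (p w * Rabs (- ln (atom_prob p xi A w) - entropy p xi A)) <=
  varentropy p xi A / (2 * lam) + lam / 2.
Proof.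
move=> [p0 p1] l0.
apply: (Rle_trans _ (\big[Rplus/0]_w (/ (2 * lam) *
    (p w * (- ln (atom_prob p xi A w) - entropy p xi A) ^ 2) + lam / 2 * p w))); last first.
  by rewrite big_split /= !rsum_mull p1 /varentropy; right; rewrite /Rdiv /=; ring.
apply: rsum_le => w _; set d := _ - entropy p xi A.
have -> : / (2 * lam) * (p w * d ^ 2) + lam / 2 * p w = p w * ((d ^ 2 + lam ^ 2) / (2 * lam)).
  by field; lra.
apply: Rmult_le_compat_l; first exact: Rlt_le.
apply: (Rmult_le_reg_r (2 * lam)); first by lra.
have -> : (d ^ 2 + lam ^ 2) / (2 * lam) * (2 * lam) = d ^ 2 + lam ^ 2 by field; lra.
by have := pow2_abs d; have := pow2_ge_0 (Rabs d - lam); nra.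
Qed.

(* [r] is the free expansion of [f]: each [e : E] is placed freely, with unit
   weight, on the flat spanned by [phi e]. *)
Lemma almost_entropic_expansion (M E : finType) (f : {set M} -> R) (phi : E -> {set M})
  (r : {set E} -> R) :
  almost_entropic f ->
  (forall J K, r J <= f K + INR (hash_cost phi J K)) ->
  (forall J, exists K, r J = f K + INR (hash_cost phi J K)) ->
  almost_entropic r.
Proof.
move=> hf hr hr' e e0.
have l2 : 0 < ln 2 by rewrite -ln_1; apply: ln_increasing; lra.
set S := INR #|{set E}|; set T := INR #|{set M}|.
have S0 : 1 <= S by apply: (le_INR 1); apply/leP/card_gt0P; exists set0.
have T0 : 1 <= T by apply: (le_INR 1); apply/leP/card_gt0P; exists set0.
have LT : 0 <= ln T by rewrite -ln_1; apply: ln_mono; lra.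
(* With this accuracy hashing costs at most [4 * S * c / ln 2 = 2 * e / 5], the approximation of [f]
   at most [e / 20], and the final rescaling [e / 4]. *)
pose c := e * ln 2 / (2 * (5 * S)).
have c0 : 0 < c by apply: Rdiv_lt_0_compat; nra.
(* A block of [N] bits has entropy up to [N * ln 2] in natural units, so [ln 2 * f] is
   approximated. *)
have [|g [/entropic_positive[Om [p [xi [hp hg]]]] fg]] :=
  almost_entropic_scale hf (Rlt_le _ _ l2) (eps := c / 2); first by lra.
pose W := \big[Rplus/0]_(K : {set M}) varentropy p xi K.
have W0 : 0 <= W.
  apply: rsum_ge0 => K _; apply: rsum_ge0 => w _; apply: Rmult_le_pos; last exact: pow2_ge_0.
  exact: Rlt_le (hp.1 w).
(* With [lam = N * d], the [lam / 2] terms of the [T] sets add up to exactly [N * c]. *)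
pose d := 2 * c / T.
have d0 : 0 < d by apply: Rdiv_lt_0_compat; lra.
(* Both [ln T] and the variance term [W / (2 * d)] are bounded independently of [N], so a large [N]
   brings each below [N * c]. *)
have [N hN] := INR_unbounded (1 + ln T / c + W / (2 * d * c)).
have t1 : 0 <= ln T / c by apply: Rle_mult_inv_pos.
have t2 : 0 <= W / (2 * d * c) by apply: Rle_mult_inv_pos => //; nra.
have N0 : 0 < INR N by lra.
have NL : ln T <= INR N * c.
  have -> : ln T = ln T / c * c by field; lra.
  by apply: Rmult_le_compat_r; lra.
have NW : W / (2 * d) <= INR N * c.
  have -> : W / (2 * d) = W / (2 * d * c) * c by field; lra.
  by apply: Rmult_le_compat_r; lra.
have [Om' [p' [xi' [hp' he hv]]]] := iid_copies xi N hp.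
have m0 : (0 < expn 2 N)%nat by rewrite expn_gt0.
have lm : ln (INR (expn 2 N)) = INR N * ln 2.
  by rewrite INR_expn2 ln_pow //; lra.
have cost J K : entropy p' xi' K + INR (hash_cost phi J K) * ln (INR (expn 2 N)) =
    INR N * (g K + ln 2 * INR (hash_cost phi J K)) by rewrite he lm hg; ring.
have near K : ln 2 * f K - c / 2 <= g K <= ln 2 * f K + c / 2.
  by have /Rabs_def2 := fg K; lra.
pose r0 J := INR N * (ln 2 * r J - c / 2).
pose u0 J := INR N * (ln 2 * r J + c / 2).
have [|J|h [eh hh]] := @hashing Om' M E p' xi' phi (expn 2 N) hp' m0 r0 u0.
- move=> J K; rewrite cost /r0; apply: Rmult_le_compat_l; first by lra.
  by have := near K; have := Rmult_le_compat_l _ _ _ (Rlt_le _ _ l2) (hr J K); lra.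
- have [K hK] := hr' J; exists K; rewrite cost /u0; apply: Rmult_le_compat_l; first by lra.
  by have := near K; rewrite hK; lra.
have hD : \big[Rplus/0]_(K : {set M}) \big[Rplus/0]_w
    (p' w * Rabs (- ln (atom_prob p' xi' K w) - entropy p' xi' K)) <= 2 * (INR N * c).
  apply: (Rle_trans _ (\big[Rplus/0]_(K : {set M})
     (/ (2 * d) * varentropy p xi K + INR N * d / 2))).
    apply: rsum_le => K _; apply: Rle_trans (mean_deviation_le xi' K hp' (lam := INR N * d) _) _.
      exact: Rmult_lt_0_compat.
    by rewrite hv; right; field; lra.
  rewrite big_split /= rsum_mull rsum_const -/W -/T.
  have -> : T * (INR N * d / 2) = INR N * c by rewrite /d; field; lra.
  by rewrite Rmult_comm -/(Rdiv W _); lra.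
move: hh hD; set D := \big[Rplus/0]_(K : {set M}) _ => hh hD.
(* Per set the deficit is at most [4 * N * c]: one unit from [u0 - r0], one from [ln T] and two from
   the deviations. *)
have bnd J : u0 J - S * (INR N * (4 * c)) <= h J <= u0 J.
  have [h1 h2] := hh J; split=> //; apply: Rle_trans h1.
  apply: Rplus_le_compat_l; apply: Ropp_le_contravar.
  rewrite /S -rsum_const; apply: rsum_le => J' _.
  by rewrite /u0 /r0 -/T; lra.
have ae : almost_entropic h by move=> eps eps0; exists h; split=> // A; rewrite Rminus_diag Rabs_R0.
have Nl0 : 0 < / (INR N * ln 2) by apply: Rinv_0_lt_compat; exact: Rmult_lt_0_compat.
have [|k [ek hk]] := almost_entropic_scale ae (Rlt_le _ _ Nl0) (eps := e / 4); first by lra.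
exists k; split=> // J; have /Rabs_def2 hkJ := hk J; have [b1 b2] := bnd J.
have q1 := Rmult_le_compat_l _ _ _ (Rlt_le _ _ Nl0) b1.
have q2 := Rmult_le_compat_l _ _ _ (Rlt_le _ _ Nl0) b2.
have e1 : / (INR N * ln 2) * u0 J = r J + c / (2 * ln 2) by rewrite /u0; field; lra.
have e2 : / (INR N * ln 2) * (u0 J - S * (INR N * (4 * c))) = r J + c / (2 * ln 2) - 4 * S * c / ln 2.
  by rewrite /u0; field; lra.
have e3 : S * c / ln 2 = e / 10 by rewrite /c; field; lra.
have e4 : c / ln 2 <= e / 10.
  by rewrite -e3; apply: Rmult_le_compat_r; [apply: Rlt_le; exact: Rinv_0_lt_compat | nra].
have e5 : 0 < c / ln 2 by exact: Rdiv_lt_0_compat.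
have e6 : c / (2 * ln 2) = c / ln 2 / 2 by field; lra.
rewrite e2 e6 in q1; rewrite e1 e6 in q2.
have e7 : 4 * S * c / ln 2 = 4 * (S * c / ln 2) by field; lra.
by apply: Rabs_def1; lra.
Qed.

(** * A non-Shannon inequality *)

(* Two copies of the probability space are glued along [xi_U]; the variables in
   [W] are read off the second copy. *)
Lemma entropic_copy (M : finType) (f : {set M} -> R) (U W : {set M}) :
  entropic f -> [disjoint U & W] ->
  exists g, [/\ entropic g,
    forall J : {set M}, [disjoint J & W] -> g J = f J,
    forall J : {set M}, J \subset U :|: W -> g J = f J &
    forall J : {set M}, U \subset J -> [disjoint J & W] -> g (J :|: W) = f J + f (U :|: W) - f U].
Proof.
move=> /entropic_positive[Om [p [xi [[p0 p1] hf]]]] dUW.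
have q0 A w : 0 < atom_prob p xi A w by exact: atom_gt0.
(* Two copies of [p] made conditionally independent given [xi] on [U]. *)
pose p' (w : Om * Om) := if same xi U w.1 w.2 then p w.1 * p w.2 / atom_prob p xi U w.1 else 0.
pose xi' (i : M) (w : Om * Om) := if i \in W then xi i w.2 else xi i w.1.
have marg1 w1 : \big[Rplus/0]_w2 p' (w1, w2) = p w1.
  rewrite /p' /= -big_mkcond /= (eq_bigr (fun w2 => p w1 / atom_prob p xi U w1 * p w2)).
    by rewrite rsum_mull -atomE; field; have := q0 U w1; lra.
  by move=> w2 _; rewrite /Rdiv; ring.
have marg2 w2 : \big[Rplus/0]_w1 p' (w1, w2) = p w2.
  rewrite /p' /= -big_mkcond /= (eq_bigl (same xi U w2)) => [|w1]; last by rewrite same_sym.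
  rewrite (eq_bigr (fun w1 => p w2 / atom_prob p xi U w2 * p w1)).
    by rewrite rsum_mull -atomE; field; have := q0 U w2; lra.
  by move=> w1 h; rewrite (atom_congr p h) /Rdiv; ring.
have mean1 F : \big[Rplus/0]_w (p' w * F w.1) = \big[Rplus/0]_w (p w * F w).
  rewrite -(pair_bigA _ (fun w1 w2 => p' (w1, w2) * F w1)) /=.
  by apply: eq_bigr => w1 _; rewrite rsum_mulr marg1.
have mean2 F : \big[Rplus/0]_w (p' w * F w.2) = \big[Rplus/0]_w (p w * F w).
  rewrite -(pair_bigA _ (fun w1 w2 => p' (w1, w2) * F w2)) exchange_big /=.
  by apply: eq_bigr => w2 _; rewrite rsum_mulr marg2.
have notW (J : {set M}) i : [disjoint J & W] -> i \in J -> (i \in W) = false.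
  by move=> /pred0P/(_ i) /=; case: (i \in W); rewrite ?andbT // => ->.
have sameJ (J : {set M}) w w' : [disjoint J & W] -> same xi' J w w' = same xi J w.1 w'.1.
  by move=> d; apply/sameP/sameP => h i iJ; have := h i iJ; rewrite /xi' (notW J).
have sameW w w' : same xi' W w w' = same xi W w.2 w'.2.
  by apply/sameP/sameP => h i iJ; have := h i iJ; rewrite /xi' iJ.
exists (entropy p' xi'); split.
- exists (Om * Om)%type, p', xi'; split; [|split=> //].
    move=> w; rewrite /p'; case: ifP => _; last by lra.
    by apply: Rlt_le; apply: Rdiv_lt_0_compat => //; exact: Rmult_lt_0_compat.
  have := mean1 (fun=> 1); rewrite !rsum_mulr p1 Rmult_1_l => <-.
  by rewrite Rmult_1_r.
- move=> J dJ; rewrite hf /entropy; congr (- _).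
  rewrite -mean1; apply: eq_bigr => w _; congr (_ * ln _).
  rewrite !atomE (eq_bigl (fun w' => same xi J w.1 w'.1 && true)).
    rewrite -(pair_big (same xi J w.1) xpredT (fun w1 w2 => p' (w1, w2))) /=.
    by apply: eq_bigr => w1 _; exact: marg1.
  by move=> w'; rewrite sameJ ?andbT.
(* The mass sits on pairs agreeing on [U], so the variables in [U] may be read off the second copy
   as well, and its marginal is again [p]. *)
- move=> J JUW; rewrite hf /entropy; congr (- _).
  rewrite -mean2; apply: eq_bigr => w _.
  case: (boolP (same xi U w.1 w.2)) => hw; last by rewrite /p' (negPf hw) !Rmult_0_l.
  congr (_ * ln _).
  rewrite !atomE big_mkcond /= (eq_bigr (fun w' => p' w' * (if same xi J w.2 w'.2 then 1 else 0))).
    rewrite (mean2 (fun w' => if same xi J w.2 w' then 1 else 0)) [RHS]big_mkcond /=.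
    by apply: eq_bigr => w' _; case: ifP => _; lra.
  move=> w' _; case: (boolP (same xi U w'.1 w'.2)) => hw'; last first.
    by rewrite /p' (negPf hw'); case: ifP => _; lra.
  have -> : same xi' J w w' = same xi J w.2 w'.2.
    apply/sameP/sameP => h i iJ; have := h i iJ; rewrite /xi'; case: (boolP (i \in W)) => // iW.
      have iU : i \in U by have := subsetP JUW i iJ; rewrite inE (negPf iW) orbF.
      by rewrite (sameP _ _ _ _ hw) // (sameP _ _ _ _ hw').
    have iU : i \in U by have := subsetP JUW i iJ; rewrite inE (negPf iW) orbF.
    by rewrite (sameP _ _ _ _ hw) // (sameP _ _ _ _ hw').
  by case: ifP => _; lra.
move=> J UJ dJ.
(* On the support, conditional independence factors the atom probability of [J :|: W]; taking
   logarithms separates the two marginals. *)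
have key w : p' w * ln (atom_prob p' xi' (J :|: W) w) =
    p' w * ln (atom_prob p xi J w.1) + p' w * ln (atom_prob p xi (U :|: W) w.2) +
    p' w * - ln (atom_prob p xi U w.1).
  case: (boolP (same xi U w.1 w.2)) => hw; last by rewrite /p' (negPf hw); lra.
  suff -> : atom_prob p' xi' (J :|: W) w =
     atom_prob p xi J w.1 * atom_prob p xi (U :|: W) w.2 / atom_prob p xi U w.1.
    by rewrite ln_div ?ln_mult //; [lra | exact: Rmult_lt_0_compat].
  rewrite (atomE p' xi') (atomE p xi J) (atomE p xi (U :|: W)) big_distrlr pair_big /=.
  rewrite /Rdiv -rsum_mulr big_mkcond [RHS]big_mkcond /=; apply: eq_bigr => w' _.
  rewrite !same_setU sameJ // sameW.
  case: (boolP (same xi J w.1 w'.1)) => //= hJ; case: (same xi W w.2 w'.2) => //=; last first.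
    by rewrite andbF.
  have hU := same_sub UJ hJ; rewrite andbT /p' -(same_congr _ hU) (same_congr _ hw).
  by rewrite (atom_congr p hU).
rewrite !hf /entropy (eq_bigr _ (fun w _ => key w)) !big_split /=.
rewrite (mean1 (fun w => ln (atom_prob p xi J w))).
rewrite (mean2 (fun w => ln (atom_prob p xi (U :|: W) w))).
rewrite (mean1 (fun w => - ln (atom_prob p xi U w))).
have -> : \big[Rplus/0]_w (p w * - ln (atom_prob p xi U w)) =
    - (\big[Rplus/0]_w (p w * ln (atom_prob p xi U w))).
  by rewrite -rsumN; apply: eq_bigr => w _; lra.
by lra.
Qed.

Section FiveVariables.
Context {M : finType} (z a b c d e : {set M}).

Definition sel (x : bool) (A : {set M}) : {set M} := if x then A else set0.
Definition join5 (xa xb xc xd xe : bool) : {set M} :=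
  z :|: sel xa a :|: sel xb b :|: sel xc c :|: sel xd d :|: sel xe e.

(* The Ingleton expression of [a, b; c, d] plus [I(a;b|e) + I(a;e|b) + I(b;e|a)],
   all conditioned on [z] (Makarychev, Makarychev, Romashchenko, Vereshchagin). *)
Definition mmrv (f : {set M} -> R) : R :=
  let H xa xb xc xd xe := f (join5 xa xb xc xd xe) in
  H true false true false false + H false true true false false
  + H true false false true false + H false true false true false
  + 3 * H true true false false false
  + 2 * H true false false false true + 2 * H false true false false true
  - H true true true false false - H true true false true false
  - H false false true true false
  - 2 * H true false false false false - 2 * H false true false false false
  - H false false false false true - 3 * H true true false false true.

Lemma mem_join5 xa xb xc xd xe i :
  (i \in join5 xa xb xc xd xe) = [|| i \in z, xa && (i \in a), xb && (i \in b),
     xc && (i \in c), xd && (i \in d) | xe && (i \in e)].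
Proof.
have mem_sel x A : (i \in sel x A) = x && (i \in A) by case: x; rewrite /sel ?inE.
by rewrite !in_setU !mem_sel -!orbA.
Qed.

(** The hypothesis states that [e] is independent of [c], [d] given [z], [a], [b]. Under it the
    inequality is a combination of ten instances of submodularity. *)
Lemma polymatroid_mmrv (f : {set M} -> R) : polymatroid f ->
  f (join5 true true true true true) + f (join5 true true false false false) =
  f (join5 true true true true false) + f (join5 true true false false true) ->
  0 <= mmrv f.
Proof.
move=> [_ [_ [mono sub]]] ind; rewrite /mmrv.
pose H := fun xa xb xc xd xe => f (join5 xa xb xc xd xe).
have S xa xb xc xd xe ya yb yc yd ye :
    H (xa || ya) (xb || yb) (xc || yc) (xd || yd) (xe || ye)
    + H (xa && ya) (xb && yb) (xc && yc) (xd && yd) (xe && ye)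
    <= H xa xb xc xd xe + H ya yb yc yd ye.
  apply: Rle_trans (sub _ _).
  have -> : join5 xa xb xc xd xe :|: join5 ya yb yc yd ye =
      join5 (xa || ya) (xb || yb) (xc || yc) (xd || yd) (xe || ye).
    apply/setP => i; rewrite in_setU !mem_join5 !andb_orl.
    by case: (i \in z) => //=; do 5!case: (_ && _) => //=; rewrite ?orbT.
  (* The sets may overlap, so the join of the common variables is only contained in the
     intersection; monotonicity covers the difference. *)
  apply: Rplus_le_compat_l; apply: mono; apply/subsetP => i; rewrite in_setI !mem_join5.
  case: (i \in z) => //=.
  by do 4?[case/orP]; move=> /andP[/andP[-> ->] ->]; rewrite ?orbT.
have s1 := S true false true false true false true true false true.
have s2 := S true false true false false true false false false true.
have s3 := S false true true false false false true false false true.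
have s4 := S true false false true true false true false true true.
have s5 := S true false false true false true false false false true.
have s6 := S false true false true false false true false false true.
have s7 := S true true true false true true true true true false.
have s8 := S true true false true true true true true true false.
have s9 := S false false true false true false false false true true.
have s10 := S false false true true true true true true true false.
by move: s1 s2 s3 s4 s5 s6 s7 s8 s9 s10; rewrite /H /= => *; lra.
Qed.

(** No term of [mmrv] joins [e] with [c] or [d]. Replacing [e] by its copy over [z], [a], [b] thus
    preserves the value and supplies the independence hypothesis. *)
Lemma entropic_mmrv (f : {set M} -> R) : entropic f ->
  [disjoint z & e] -> [disjoint a & e] -> [disjoint b & e] -> [disjoint c & e] ->
  [disjoint d & e] -> 0 <= mmrv f.
Proof.
move=> hf dz da db dc dd.
have dj xa xb xc xd : [disjoint join5 xa xb xc xd false & e].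
  apply/pred0P => i; rewrite /= mem_join5.
  move: (pred0P dz i) (pred0P da i) (pred0P db i) (pred0P dc i) (pred0P dd i) => /=.
  by case: (i \in e); rewrite ?andbT ?andbF // => -> -> -> -> ->; rewrite !andbF.
have [g [eg g1 g2 g3]] := entropic_copy hf (dj true true false false).
have gj xa xb xc xd : g (join5 xa xb xc xd false) = f (join5 xa xb xc xd false) by exact: g1.
have eE xa xb xc xd : join5 xa xb xc xd true = join5 xa xb xc xd false :|: e.
  by rewrite /join5 /= setU0.
have ge xa xb : g (join5 xa xb false false true) = f (join5 xa xb false false true).
  apply: g2; rewrite eE setSU //; apply/subsetP => i; rewrite !mem_join5 /= !orbF.
  by case: (i \in z) xa xb => [] [] [] //=; rewrite ?orbF => ->; rewrite ?orbT.
have <- : mmrv g = mmrv f by rewrite /mmrv !gj !ge.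
apply: polymatroid_mmrv; first exact: entropic_polymatroid.
rewrite eE g3 //; last first.
  apply/subsetP => i; rewrite !mem_join5 /= !orbF => /or3P[|->|->]; rewrite ?orbT //.
  by move=> ->.
by rewrite !gj ge -eE; lra.
Qed.

Lemma almost_entropic_mmrv (f : {set M} -> R) : almost_entropic f ->
  [disjoint z & e] -> [disjoint a & e] -> [disjoint b & e] -> [disjoint c & e] ->
  [disjoint d & e] -> 0 <= mmrv f.
Proof.
move=> hf dz da db dc dd; apply: Rnot_lt_le => neg.
(* The absolute values of the coefficients of [mmrv] add up to 22. *)
have [|g [eg hg]] := hf (- mmrv f / 22); first by lra.
have := entropic_mmrv eg dz da db dc dd.
have bd A : g A - f A < - mmrv f / 22 /\ f A - g A < - mmrv f / 22.
  by have /Rabs_def2 := hg A; lra.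
have := bd (join5 true false true false false).
have := bd (join5 false true true false false).
have := bd (join5 true false false true false).
have := bd (join5 false true false true false).
have := bd (join5 true true false false false).
have := bd (join5 true false false false true).
have := bd (join5 false true false false true).
have := bd (join5 true true true false false).
have := bd (join5 true true false true false).
have := bd (join5 false false true true false).
have := bd (join5 true false false false false).
have := bd (join5 false true false false false).
have := bd (join5 false false false false true).
have := bd (join5 true true false false true).
set D := - mmrv f / 22; have : 22 * D = - mmrv f by rewrite /D; lra.
by clearbody D; rewrite /mmrv => *; lra.
Qed.

End FiveVariables.

(** * An integer polymatroid violating the dual inequality *)

(** The entropy, in bits, of one fair bit shared by all members of [K]. *)
Definition hits (M : finType) (K A : {set M}) : R := if [disjoint A & K] then 0 else 1.

Lemma almost_entropic_hits (M : finType) (K : {set M}) : almost_entropic (hits K).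
Proof.
pose p (_ : bool) := 1 / 2; pose xi (i : M) (w : bool) := nat_of_bool ((i \in K) && w).
have l2 : 0 < ln 2 by rewrite -ln_1; apply: ln_increasing; lra.
have hp : positive_pmf p by split=> [w|]; rewrite /p ?big_bool /=; lra.
have e A : entropy p xi A = ln 2 * hits K A.
  rewrite /entropy /hits; case: (boolP [disjoint A & K]) => dAK.
    rewrite big1; first by lra.
    move=> w _; suff -> : atom_prob p xi A w = 1 by rewrite ln_1; lra.
    rewrite -hp.2 atomE; apply: eq_bigl => w'; apply/sameP => i iA.
    by rewrite /xi (disjointFr dAK).
  have [i iA iK] : exists2 i, i \in A & i \in K.
    by apply/exists_inP; rewrite -[X in is_true X]negbK; move: dAK; rewrite /disjoint;
      apply: contra => h; apply/pred0P => i /=; apply/negP => /andP[iA iK];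
      move/exists_inP: h; apply; exists i.
  have at2 w : atom_prob p xi A w = 1 / 2.
    rewrite atomE (eq_bigl (pred1 w)) ?big_pred1_eq // => w' /=.
    apply/sameP/eqP => [/(_ i iA) | -> //].
    by rewrite /xi iK; case: w w' => [] [].
  rewrite big_bool /= !at2 /p ln_div ?ln_1; lra.
have ae : almost_entropic (entropy p xi).
  move=> eps eps0; exists (entropy p xi); split; last by move=> A; rewrite Rminus_diag Rabs_R0.
  by apply/entropic_positive; exists bool, p, xi.
have i2 : 0 <= / ln 2 by apply: Rlt_le; exact: Rinv_0_lt_compat.
apply: almost_entropic_ext (almost_entropic_scale ae i2) => A.
by rewrite e; field; lra.
Qed.

Lemma almost_entropic_sum (M I : finType) (f : I -> {set M} -> R) :
  (forall i, almost_entropic (f i)) -> almost_entropic (fun A => \big[Rplus/0]_i f i A).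
Proof.
move=> h; suff H (s : seq I) : almost_entropic (fun A => \big[Rplus/0]_(i <- s) f i A).
  by apply: almost_entropic_ext (H (index_enum I)).
elim: s => [|i s ih].
  apply: (@almost_entropic_ext _ (fun=> 0)) => [A|]; first by rewrite big_nil.
  move=> eps eps0; exists (fun=> 0); split; first exact: entropic0.
  by move=> A; rewrite Rminus_diag Rabs_R0.
by apply: almost_entropic_ext (almost_entropic_add (h i) ih) => A; rewrite big_cons.
Qed.

(** Möbius inversion on the subset lattice, solved by recursion on cardinality. *)
Lemma subset_sum_inversion (M : finType) (g : {set M} -> R) :
  exists mu : {set M} -> R, forall B, g B = \big[Rplus/0]_(K : {set M} | K \subset B) mu K.
Proof.
suff H n : exists mu : {set M} -> R, forall B : {set M}, (#|B| < n)%nat ->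
    g B = \big[Rplus/0]_(K : {set M} | K \subset B) mu K.
  by have [mu h] := H #|M|.+1; exists mu => B; apply: h; rewrite ltnS max_card.
elim: n => [|n [mu ih]]; first by exists (fun=> 0).
pose mu' (K : {set M}) := if #|K| == n
  then g K - \big[Rplus/0]_(L : {set M} | (L \subset K) && (L != K)) mu L else mu K.
exists mu' => B; rewrite ltnS leq_eqVlt => /orP[/eqP cB | lB].
  rewrite (bigD1 B) //= {1}/mu' cB eqxx.
  rewrite [X in _ + X](eq_bigr mu); first by rewrite /Rminus Rplus_assoc Rplus_opp_l Rplus_0_r.
  move=> K /andP[sK nK]; rewrite /mu' ifN // -cB neq_ltn proper_card //.
  by rewrite properEneq nK.
rewrite ih //; apply: eq_bigr => K /subset_leq_card cK.
by rewrite /mu' ifN // neq_ltn (leq_ltn_trans cK lB).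
Qed.

(** Sets [K] missing [A] are the subsets of the complement of [A], so inverting [f setT - f (~: B)]
    expresses [f] in the functions [hits K]. The coefficients may be negative. *)
Lemma hits_decomposition (M : finType) (f : {set M} -> R) : f set0 = 0 ->
  exists lam : {set M} -> R, forall A, f A = \big[Rplus/0]_K (lam K * hits K A).
Proof.
move=> f0; have [lam h] := subset_sum_inversion (fun B => f setT - f (~: B)).
exists lam => A.
have h1 := h setT; have h2 := h (~: A); rewrite setCT f0 in h1; rewrite setCK in h2.
have E : \big[Rplus/0]_(K : {set M}) lam K =
   \big[Rplus/0]_K (lam K * hits K A) + \big[Rplus/0]_(K : {set M} | K \subset ~: A) lam K.
  rewrite [X in _ + X]big_mkcond -big_split /=; apply: eq_bigr => K _.
  by rewrite /hits disjoint_sym disjoints_subset; case: ifP => _; lra.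
have E' : \big[Rplus/0]_(K : {set M} | K \subset setT) lam K = \big[Rplus/0]_(K : {set M}) lam K.
  by apply: eq_bigl => K; rewrite subsetT.
by move: h1; rewrite E' E; lra.
Qed.

(* Rounding the coefficients of [n * f] up in the basis [hits K] only adds
   non-negative multiples of entropic functions. *)
Lemma almost_entropic_round (M : finType) (f : {set M} -> R) (n : nat) :
  almost_entropic f -> exists2 F : {set M} -> nat, almost_entropic (fun A => INR (F A)) &
    forall A, INR n * f A <= INR (F A) <= INR n * f A + INR #|{set M}|.
Proof.
move=> hf; have [f0 _] := almost_entropic_polymatroid hf.
have [lam hlam] := hits_decomposition f0.
pose eps K := IZR (up (INR n * lam K)) - INR n * lam K.
have eps01 K : 0 <= eps K <= 1 by rewrite /eps; have := archimed (INR n * lam K); lra.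
have hits01 K A : 0 <= @hits M K A <= 1 by rewrite /hits; case: ifP => _; lra.
pose g A := INR n * f A + \big[Rplus/0]_K (eps K * hits K A).
have ag : almost_entropic g.
  apply: almost_entropic_add; first exact: almost_entropic_scale (pos_INR n).
  apply: almost_entropic_sum => K; apply: almost_entropic_scale (almost_entropic_hits K) _.
  by have := eps01 K; lra.
(* The integer value of [g], computed from the rounded coefficients. As [g] is non-negative,
   converting it to [nat] loses nothing. *)
pose Zg (A : {set M}) : Z := \big[Z.add/0%Z]_(K : {set M}) (if [disjoint A & K] then 0%Z else up (INR n * lam K)).
have gZ A : g A = IZR (Zg A).
  rewrite /Zg (big_morph IZR plus_IZR (erefl _)) /g hlam -rsum_mull -big_split /=.
  by apply: eq_bigr => K _; rewrite /eps /hits; case: ifP => _; lra.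
have g0 A : 0 <= g A by case: (almost_entropic_polymatroid ag) => _ [].
exists (fun A => Z.to_nat (Zg A)).
  apply: almost_entropic_ext ag => A.
  by rewrite INR_IZR_INZ Z2Nat.id -?gZ //; apply: le_IZR; rewrite -gZ.
move=> A; rewrite (INR_IZR_INZ (Z.to_nat _)) Z2Nat.id; last by apply: le_IZR; rewrite -gZ.
rewrite -gZ /g; split.
  suff : 0 <= \big[Rplus/0]_K (eps K * hits K A) by lra.
  by apply: rsum_ge0 => K _; have := eps01 K; have := hits01 K A; nra.
apply: Rplus_le_compat_l; rewrite -[X in _ <= X]Rmult_1_r -rsum_const; apply: rsum_le => K _.
by have := eps01 K; have := hits01 K A; nra.
Qed.

Definition five (xa xb xc xd xe : bool) : {set 'I_5} :=
  [set i : 'I_5 | nth false [:: xa; xb; xc; xd; xe] i].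

(* The expression dual to [mmrv]: every set is replaced by its complement. *)
Definition mmrv_dual (f : {set 'I_5} -> R) : R :=
  let H xa xb xc xd xe := f (five xa xb xc xd xe) in
  H false true false true true + H true false false true true
  + H false true true false true + H true false true false true
  + 3 * H false false true true true
  + 2 * H false true true true false + 2 * H true false true true false
  - H false false false true true - H false false true false true
  - H true true false false true
  - 2 * H false true true true true - 2 * H true false true true true
  - H true true true true false - 3 * H false false true true false.

Local Notation cube := (bool * bool * bool)%type.

(* Three independent fair bits [a], [b], [e]. Given [e], the variables [c] and [d]
   are the indicators of two opposite corners of the square [(a, b)], which
   violates the Ingleton inequality. Given [(c, d)], the triple [(a, b, e)] is
   either determined, or uniform on the triples with [a + b + e] odd and hence
   pairwise independent, so the correction terms of the inequality vanish. *)
Definition cube_rv (i : 'I_5) (w : cube) : nat :=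
  let: (a, b, e) := w in
  nth O [:: nat_of_bool a; nat_of_bool b;
            if b && (a != e) then e.+1 else O;
            if ~~ b && (a == e) then e.+1 else O; nat_of_bool e] i.

Definition cube_pmf (_ : cube) : R := 1 / 8.

Lemma sum_cube (F : cube -> R) : \big[Rplus/0]_w F w =
  F (true, true, true) + F (true, true, false) + F (true, false, true) + F (true, false, false)
  + F (false, true, true) + F (false, true, false) + F (false, false, true) + F (false, false, false).
Proof.
rewrite (eq_bigr (fun w => F (w.1.1, w.1.2, w.2))) => [|[[? ?] ?] //].
rewrite -(pair_bigA _ (fun x y => F (x.1, x.2, y))).
rewrite -(pair_bigA _ (fun x y => \big[Rplus/0]_z F (x, y, z))) /=.
by rewrite !big_bool /=; ring.
Qed.

Definition cube_list : seq cube :=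
  [:: (true, true, true); (true, true, false); (true, false, true); (true, false, false);
      (false, true, true); (false, true, false); (false, false, true); (false, false, false)].

(** A form of [same] on explicit ordinals that evaluates by reduction, so that atom sizes can be
    counted by computation. *)
Definition cube_same (xa xb xc xd xe : bool) (w w' : cube) : bool :=
  all (fun i => nth false [:: xa; xb; xc; xd; xe] (val i) ==> (cube_rv i w' == cube_rv i w))
    [:: @Ordinal 5 0 isT; @Ordinal 5 1 isT; @Ordinal 5 2 isT; @Ordinal 5 3 isT; @Ordinal 5 4 isT].

Definition cube_count (xa xb xc xd xe : bool) (w : cube) : nat :=
  count (cube_same xa xb xc xd xe w) cube_list.

Lemma same_five xa xb xc xd xe w w' :
  same cube_rv (five xa xb xc xd xe) w w' = cube_same xa xb xc xd xe w w'.
Proof.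
apply/sameP/allP => h i hi; first by apply/implyP => hx; apply/eqP/h; rewrite inE.
apply/eqP; have /h : i \in [:: @Ordinal 5 0 isT; @Ordinal 5 1 isT; @Ordinal 5 2 isT;
    @Ordinal 5 3 isT; @Ordinal 5 4 isT].
  by rewrite !inE -!val_eqE /=; case: i {hi} => [[|[|[|[|[|]]]]]].
by rewrite inE in hi; rewrite hi.
Qed.

Lemma atom_cube xa xb xc xd xe w :
  atom_prob cube_pmf cube_rv (five xa xb xc xd xe) w =
  INR (cube_count xa xb xc xd xe w) / 8.
Proof.
rewrite atomE big_mkcond sum_cube /cube_count !same_five.
have bE (x : bool) : INR x = if x then 1 else 0 by case: x.
rewrite /count !plus_INR !bE /cube_pmf.
by rewrite [INR 0]/=; do 8![case: (cube_same _ _ _ _ _ _ _)]; lra.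
Qed.

Lemma entropy_cube xa xb xc xd xe :
  entropy cube_pmf cube_rv (five xa xb xc xd xe) =
  ln 8 - foldr Rplus 0 [seq ln (INR (cube_count xa xb xc xd xe w)) | w <- cube_list] / 8.
Proof.
have c0 w : 0 < INR (cube_count xa xb xc xd xe w).
  have : 0 < INR (cube_count xa xb xc xd xe w) / 8; last by lra.
  by rewrite -atom_cube; apply: atom_gt0 => ?; rewrite /cube_pmf; lra.
have lE w : ln (atom_prob cube_pmf cube_rv (five xa xb xc xd xe) w) =
    ln (INR (cube_count xa xb xc xd xe w)) - ln 8.
  by rewrite atom_cube ln_div //; lra.
by rewrite /entropy sum_cube !lE /cube_pmf /=; lra.
Qed.

(** The [ln 8] terms cancel because the coefficients sum to zero. The remaining value is
    [(3 ln 3 - 5 ln 2) / 2], negative since 27 is less than 32. *)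
Lemma mmrv_dual_cube : mmrv_dual (entropy cube_pmf cube_rv) < 0.
Proof.
have e1 : ln (INR 1) = 0 by rewrite ln_1.
have e4 : ln (INR 4) = 2 * ln (INR 2).
  have -> : INR 4 = INR 2 * INR 2 by rewrite /=; lra.
  by rewrite ln_mult /=; lra.
have e23 : 3 * ln (INR 3) < 5 * ln (INR 2).
  have -> : 3 * ln (INR 3) = ln (INR 3 ^ 3) by rewrite ln_pow /=; lra.
  have -> : 5 * ln (INR 2) = ln (INR 2 ^ 5) by rewrite ln_pow /=; lra.
  by apply: ln_increasing; rewrite /=; lra.
rewrite /mmrv_dual !entropy_cube /cube_count.
cbv -[INR ln Rplus Rminus Rmult Rdiv Rlt IZR].
rewrite !e1 !e4.
lra.
Qed.

(** * Matroid ports *)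

Lemma bigRmax_ge (I : finType) (F : I -> R) j : F j <= \big[Rmax/0]_i F i.
Proof.
have : j \in index_enum I by exact: mem_index_enum.
elim: (index_enum I) => // i s ih; rewrite inE big_cons => /orP[/eqP ->|/ih h].
  exact: Rmax_l.
exact: Rle_trans h (Rmax_r _ _).
Qed.

Section Hyperplanes.
Context {E : finType} (rho : {set E} -> nat).
Hypotheses (mono : forall A B : {set E}, A \subset B -> (rho A <= rho B)%nat)
  (unit : forall x (A : {set E}), (rho (x |: A) <= (rho A).+1)%nat)
  (sub : forall A B : {set E}, (rho (A :|: B) + rho (A :&: B) <= rho A + rho B)%nat).

Lemma rank_closed (A : {set E}) :
  (forall x, rho (x |: A) = rho A) -> rho setT = rho A.
Proof.
move=> h; suff H n (B : {set E}) : #|B| = n -> rho (A :|: B) = rho A.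
  by have := H _ setT erefl; rewrite setUT.
elim: n B => [|n ih] B hB; first by rewrite (cards0_eq hB) setU0.
have [i iB] : exists i, i \in B by apply/set0Pn; rewrite -card_gt0 hB.
have cB : #|B :\ i| = n by apply/eqP; rewrite -eqSS -hB (cardsD1 i B) iB.
apply/eqP; rewrite eqn_leq (mono (subsetUl A B)) andbT.
have := sub (A :|: B :\ i) (i |: A); rewrite ih // h => s.
have le : (rho A <= rho ((A :|: B :\ i) :&: (i |: A)))%nat.
  by apply: mono; rewrite subsetI subsetUl subsetUr.
have eU : A :|: B \subset (A :|: B :\ i) :|: (i |: A).
  by apply/subsetP => x; rewrite !inE; case: (x \in A); case: (x == i); case: (x \in B).
rewrite -(leq_add2r (rho A)); apply: leq_trans s.
by apply: leq_add => //; exact: mono.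
Qed.

(** Take [H] maximal among the supersets of [B] whose rank [e] raises. By maximality no further
    element raises the rank of [e |: H], which therefore spans. *)
Lemma hyperplane_avoiding (e : E) (B : {set E}) :
  rho (e |: B) = (rho B).+1 ->
  exists H : {set E}, [/\ B \subset H, e \notin H, (rho H < rho setT)%nat &
    forall x, x \notin H -> rho (x |: H) = rho setT].
Proof.
move=> he; pose Q (H : {set E}) := rho (e |: H) == (rho H).+1.
have [H /maxsetP[/eqP QH maxH] BH] : {H | maxset Q H & B \subset H}.
  by apply: maxset_exists; apply/eqP.
have eH : e \notin H.
  by apply/negP => eH; move: QH; rewrite (setUidPr _) ?sub1set // => /n_Sn.
have add x : x \notin H -> rho (e |: (x |: H)) = (rho H).+1 /\ rho (x |: H) = (rho H).+1.
  move=> xH; case: (eqVneq x e) => [->|xe]; first by rewrite setUA setUid.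
  have : ~~ Q (x |: H).
    apply/negP => Qx; have := maxH _ Qx (subsetUr _ _) => hx.
    by move: xH; rewrite -hx setU11.
  rewrite /Q; have := unit e (x |: H); rewrite leq_eqVlt => /orP[-> //|].
  rewrite ltnS => l1 _.
  have l2 : ((rho H).+1 <= rho (e |: (x |: H)))%nat by rewrite -QH mono // setUS // subsetUr.
  have l3 := unit x H.
  by split; apply/eqP; rewrite eqn_leq ?l2 ?l3 ?(leq_trans l1 l3) ?(leq_trans l2 l1).
have top : rho setT = (rho H).+1.
  rewrite -QH; apply: rank_closed => x; case: (boolP (x \in e |: H)) => [xH|].
    by rewrite (setUidPr _) // sub1set.
  by rewrite !inE negb_or => /andP[xe xH]; rewrite QH setUCA; have [->] := add x xH.
by exists H; split; rewrite ?top // => x /add[].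
Qed.

End Hyperplanes.

(** * Free expansions of integer polymatroids *)

Section Expansion.
Context {M E : finType} (F : {set M} -> nat) (phi : E -> {set M}).

(** The rank formula of the free expansion: a set [K] pays for its own value and one unit for each
    element placed outside it. *)
Definition exp_rank (J : {set E}) : nat :=
  let K := [arg min_(K < set0) (F K + hash_cost phi J K)%nat] in (F K + hash_cost phi J K)%nat.

Lemma exp_rank_le J K : (exp_rank J <= F K + hash_cost phi J K)%nat.
Proof. by rewrite /exp_rank; case: arg_minnP => // K0 _; apply. Qed.

Lemma exp_rank_ex J : exists K, exp_rank J = (F K + hash_cost phi J K)%nat.
Proof. by eexists; reflexivity. Qed.

Lemma hash_cost_mono (J J' : {set E}) K :
  J \subset J' -> (hash_cost phi J K <= hash_cost phi J' K)%nat.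
Proof.
move=> /subsetP s; apply: subset_leq_card; apply/subsetP => e; rewrite !inE.
by move=> /andP[/s -> ->].
Qed.

Lemma hash_cost_le (J : {set E}) K : (hash_cost phi J K <= #|J|)%nat.
Proof. by apply: subset_leq_card; apply/subsetP => e; rewrite inE => /andP[]. Qed.

Lemma hash_costU1 e (J : {set E}) K : e \notin J ->
  hash_cost phi (e |: J) K = (~~ (phi e \subset K) + hash_cost phi J K)%nat.
Proof.
move=> eJ; rewrite /hash_cost (cardsD1 e); congr (_ + _)%nat; first by rewrite !inE eqxx.
apply: eq_card => x; rewrite !inE; case: (eqVneq x e) => //= ->.
by rewrite (negPf eJ).
Qed.

Lemma exp_rank_mono (J J' : {set E}) : J \subset J' -> (exp_rank J <= exp_rank J')%nat.
Proof.
move=> s; have [K ->] := exp_rank_ex J'; apply: leq_trans (exp_rank_le J K) _.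
by rewrite leq_add2l hash_cost_mono.
Qed.

Lemma exp_rank_unit e (J : {set E}) : (exp_rank (e |: J) <= (exp_rank J).+1)%nat.
Proof.
case: (boolP (e \in J)) => eJ; first by rewrite (setUidPr _) ?sub1set.
have [K ->] := exp_rank_ex J; apply: leq_trans (exp_rank_le _ K) _.
rewrite hash_costU1 // addnCA -addn1 addnC; apply: leq_add => //.
by case: (_ \subset _).
Qed.

Lemma almost_entropic_exp_rank :
  almost_entropic (fun K => INR (F K)) -> almost_entropic (fun J => INR (exp_rank J)).
Proof.
move=> hF; apply: almost_entropic_expansion hF _ _.
  by move=> J K; rewrite -plus_INR; apply: le_INR; apply/leP; exact: exp_rank_le.
by move=> J; have [K ->] := exp_rank_ex J; exists K; rewrite plus_INR.
Qed.

End Expansion.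

Section Port.
Context {M : finType} (F : {set M} -> nat).
Hypotheses (aF : almost_entropic (fun K => INR (F K))) (F_gt0 : (0 < F setT)%nat).

Local Notation k := (F setT).

(** The first summand places [F [set i]] elements on each [i]. The [k.-1] generic elements fall one
    short of spanning, and any one of the others completes them. *)
Definition participant : finType := ({i : M & 'I_(F [set i])} + 'I_k.-1)%type.

Definition place (e : option participant) : {set M} :=
  match e with Some (inl u) => [set tag u] | _ => setT end.

Local Notation rk := (exp_rank F place).
Definition port_rank (A : {set participant}) : nat := rk (lift_set A).
Local Notation rho := port_rank.
(** The secret is placed generically, so it is spanned by a set of participants exactly when that
    set has full rank. *)
Definition port : {set {set participant}} := [set A | rho A == k].

Definition block (K : {set M}) : {set participant} :=
  [set e : participant | if e is inl u then tag u \in K else false].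
Definition generic : {set participant} := [set e : participant | if e is inr _ then true else false].

Let polyF : polymatroid (fun K => INR (F K)). Proof. exact: almost_entropic_polymatroid. Qed.

Let F0 : F set0 = O.
Proof. by have [h _] := polyF; apply: INR_eq. Qed.

Let F_mono (K L : {set M}) : K \subset L -> (F K <= F L)%nat.
Proof. by have [_ [_ [h _]]] := polyF; move=> /h h'; apply/leP; exact: INR_le. Qed.

Let F_subadd (K L : {set M}) : (F (K :|: L) <= F K + \sum_(i in L) F [set i])%nat.
Proof.
apply/leP; apply: INR_le; rewrite plus_INR (big_morph INR plus_INR (erefl _)).
exact: polymatroid_subadd polyF.
Qed.

Let rk_poly : polymatroid (fun J => INR (rk J)).
Proof. by apply: almost_entropic_polymatroid; exact: almost_entropic_exp_rank. Qed.

Let lift_setU (A B : {set participant}) : lift_set (A :|: B) = lift_set A :|: lift_set B.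
Proof. exact: imsetU. Qed.

Let lift_set1 (e : participant) : lift_set [set e] = [set Some e].
Proof. exact: imset_set1. Qed.

Let lift_mono (A B : {set participant}) : A \subset B -> lift_set A \subset lift_set B.
Proof. exact: imsetS. Qed.

Let Some_inj : injective (@Some participant). Proof. by move=> x y []. Qed.

Let mem_lift (A : {set participant}) e : (Some e \in lift_set A) = (e \in A).
Proof. exact: mem_imset. Qed.

Let None_lift (A : {set participant}) : None \notin lift_set A.
Proof. by apply/imsetP => -[]. Qed.

Lemma port_rank_mono (A B : {set participant}) : A \subset B -> (rho A <= rho B)%nat.
Proof. by move=> s; apply: exp_rank_mono; exact: lift_mono. Qed.

Lemma port_rank_unit e A : (rho (e |: A) <= (rho A).+1)%nat.
Proof. by rewrite /port_rank lift_setU lift_set1; exact: exp_rank_unit. Qed.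

Lemma port_rank_sub (A B : {set participant}) : (rho (A :|: B) + rho (A :&: B) <= rho A + rho B)%nat.
Proof.
have [_ [_ [_ h]]] := rk_poly; apply/leP; apply: INR_le.
have := h (lift_set A) (lift_set B); rewrite -lift_setU.
have -> : lift_set A :&: lift_set B = lift_set (A :&: B).
  by rewrite /lift_set imsetI // => x y _ _; exact: Some_inj.
by rewrite -!plus_INR.
Qed.

Let cost_lift A K : hash_cost place (lift_set A) K =
  #|[set e in A | ~~ (place (Some e) \subset K)]|.
Proof.
rewrite /hash_cost -(card_imset _ Some_inj); apply: eq_card => x; rewrite inE.
apply/andP/imsetP => [[/imsetP[e eA ->] h] | [e]]; first by exists e; rewrite // inE eA.
by rewrite inE => /andP[eA h] ->; rewrite mem_lift.
Qed.

Let cost_setT J : hash_cost place J setT = O.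
Proof. by apply/eqP; rewrite cards_eq0; apply/eqP/setP => e; rewrite !inE subsetT andbF. Qed.

Lemma exp_rank_le_top J : (rk J <= k)%nat.
Proof. by have := exp_rank_le F place J setT; rewrite cost_setT addn0. Qed.

(** Every [K] other than [setT] pays one unit for the secret; only [setT], of value [k], contains
    its place. *)
Lemma exp_rank_with_secret A :
  rk (with_secret A) = if rho A == k then k else (rho A).+1.
Proof.
have le1 := exp_rank_unit F place None (lift_set A).
have ge : (rho A <= rk (with_secret A))%nat by apply: exp_rank_mono; exact: subsetUr.
case: (eqVneq (rho A) k) => [e|ne]; apply/eqP.
  by rewrite eqn_leq exp_rank_le_top -{1}e ge.
rewrite eqn_leq le1 /=; have [K ->] := exp_rank_ex F place (with_secret A).
case: (eqVneq K setT) => [->|KT].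
  by rewrite cost_setT addn0 ltn_neqAle exp_rank_le_top andbT.
rewrite /with_secret hash_costU1 // /= subTset KT addnCA ltnS.
exact: exp_rank_le.
Qed.

Lemma card_block K : #|block K| = (\sum_(i in K) F [set i])%nat.
Proof.
have -> : #|block K| = #|[set u : {i : M & 'I_(F [set i])} | tag u \in K]|.
  rewrite -[RHS](card_imset _ (@inl_inj _ 'I_k.-1)); apply: eq_card => -[u|x].
    by rewrite mem_imset ?inE //; exact: inl_inj.
  by rewrite inE; apply/esym/imsetP => -[].
rewrite -sum1_card (eq_bigr (fun i => \sum_(j < F [set i]) 1)%nat); last first.
  by move=> i _; rewrite sum_nat_const card_ord muln1.
rewrite (sig_big_dep (fun i => i \in K) (fun _ _ => true) (fun _ _ => 1%nat)) /=.
by apply: eq_bigl => u; rewrite inE andbT.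
Qed.

Lemma card_generic : #|generic| = k.-1.
Proof.
rewrite -[RHS]card_ord -cardsT -[RHS](card_imset _ (@inr_inj {i : M & 'I_(F [set i])} _)).
apply: eq_card => -[u|x]; rewrite inE; last by rewrite mem_imset ?inE //; exact: inr_inj.
by apply/esym/imsetP => -[].
Qed.

Lemma setC_generic : ~: generic = block setT.
Proof. by apply/setP => -[u|x]; rewrite !inE. Qed.

Lemma setC_generic_block K : ~: (generic :|: block K) = block (~: K).
Proof. by apply/setP => -[u|x]; rewrite !inE. Qed.

Let cost_block L K : hash_cost place (lift_set (block L)) K = #|block (L :\: K)|.
Proof.
rewrite cost_lift; apply: eq_card => -[u|x]; rewrite !inE //=.
by rewrite sub1set andbC.
Qed.

(** The choice [K = L] gives the upper bound. Conversely, elements outside [K] cost their singleton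
    ranks, and subadditivity of [F] recovers at least [F L]. *)
Lemma port_rank_block L : rho (block L) = F L.
Proof.
apply/eqP; rewrite eqn_leq; apply/andP; split.
  have := exp_rank_le F place (lift_set (block L)) L.
  by rewrite cost_block setDv card_block big_set0 addn0.
rewrite /port_rank; have [K ->] := exp_rank_ex F place (lift_set (block L)).
rewrite cost_block card_block; apply: leq_trans (F_subadd _ _); apply: F_mono.
by apply/subsetP => i; rewrite !inE => ->; case: (i \in K).
Qed.

Lemma port_rank_setT : rho setT = k.
Proof.
apply/eqP; rewrite eqn_leq exp_rank_le_top /= -{1}(port_rank_block setT).
exact: port_rank_mono (subsetT _).
Qed.

Lemma port_rank_set0 : rho set0 = O.
Proof.
apply/eqP; rewrite -leqn0; have := exp_rank_le F place (lift_set set0) set0.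
by move=> /leq_trans; apply; rewrite F0 add0n cost_lift leqn0 cards_eq0; apply/eqP/setP => e; rewrite !inE.
Qed.

Lemma port_rank_generic : (rho generic < k)%nat.
Proof.
apply: (@leq_ltn_trans k.-1); last by rewrite ltn_predL.
have := exp_rank_le F place (lift_set generic) set0; rewrite F0 add0n => h.
apply: leq_trans h _; apply: leq_trans (hash_cost_le _ _ _) _.
by rewrite card_imset // card_generic.
Qed.

(** A proper [K] pays [k.-1] for the generic elements. The missing unit is paid by [u] itself, or
    else [K] contains its tag and [F K] is positive because [u] witnesses a positive singleton
    rank. *)
Lemma port_rank_generic_add e : e \notin generic -> rho (e |: generic) = k.
Proof.
case: e => [u|x]; last by rewrite inE.
move=> ug; apply/eqP; rewrite eqn_leq exp_rank_le_top /= /port_rank lift_setU lift_set1.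
have [K ->] := exp_rank_ex F place (Some (inl u) |: lift_set generic).
rewrite hash_costU1 ?mem_lift //.
case: (eqVneq K setT) => [->|KT]; first by rewrite leq_addr.
have -> : hash_cost place (lift_set generic) K = k.-1.
  rewrite cost_lift -card_generic; apply: eq_card => -[v|x]; rewrite !inE //=.
  by rewrite subTset KT.
rewrite addnA -{1}(prednK F_gt0) -add1n leq_add2r /= sub1set.
case: (boolP (tag u \in K)) => uK; last by rewrite addn1.
rewrite addn0; apply: (@leq_trans (F [set tag u])); last by apply: F_mono; rewrite sub1set.
by apply: leq_ltn_trans (ltn_ord (tagged u)).
Qed.

Lemma access_structure_port : access_structure port.
Proof.
split; first by apply/set0Pn; exists setT; rewrite inE port_rank_setT.
split; first by rewrite inE port_rank_set0 eq_sym -lt0n.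
move=> A B; rewrite !inE => /eqP hA AB; rewrite eqn_leq exp_rank_le_top /= -{1}hA.
exact: port_rank_mono.
Qed.

Lemma almost_ideal_port : almost_ideal port.
Proof.
exists (fun J => INR (rk J)); split=> //; split; first exact: almost_entropic_exp_rank.
have s1 : rk [set None] = 1%nat.
  have := exp_rank_with_secret set0; rewrite port_rank_set0 /with_secret /lift_set imset0 setU0.
  by rewrite eq_sym (negPf (lt0n_neq0 F_gt0)).
split.
  move=> A; rewrite s1 exp_rank_with_secret inE -/(rho A); case: (eqVneq (rho A) k) => [->|ne].
    split; split=> //; rewrite /=; lra.
  split; split=> //; rewrite S_INR; first by move=> ?; lra.
  by move=> _; rewrite /=; lra.
have le1 (e : participant) : INR (rk [set Some e]) <= 1.
  apply: (le_INR _ 1); apply/leP; have := port_rank_unit e set0.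
  by rewrite setU0 port_rank_set0 /port_rank lift_set1.
rewrite /complexity s1 [INR 1]/=.
(* Complexity exactly 1 requires a participant of rank 1, found in the block of any [i] of positive
   rank. *)
have [i Fi] : exists i, (0 < F [set i])%nat.
  apply/existsP; rewrite -[X in is_true X]negbK; apply/negP => /existsPn h.
  have := F_subadd set0 setT; rewrite set0U F0 big1 ?leqn0 => [/eqP e|i _].
    by move: F_gt0; rewrite e.
  by apply/eqP; rewrite -leqn0 leqNgt h.
pose e : participant := inl (Tagged (fun i => 'I_(F [set i])) (Ordinal Fi)).
have re : INR (rk [set Some e]) = 1.
  apply: Rle_antisym; first exact: le1.
  apply: (le_INR 1); apply/leP; have [K ->] := exp_rank_ex F place [set Some e].
  rewrite -(setU0 [set Some e]) hash_costU1 ?inE //= sub1set.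
  case: (boolP (i \in K)) => iK; last by rewrite addnCA.
  rewrite addn_gt0 (leq_trans Fi) //; apply: F_mono; by rewrite sub1set.
apply: Rle_antisym.
  elim/big_ind: _ => [|x y|j _]; [lra | exact: Rmax_lub | by have := le1 j; lra].
by apply: Rle_trans (bigRmax_ge _ e); rewrite re; lra.
Qed.

End Port.

(** * The dual port *)

Section DualPort.
Context {M : finType} (F : {set M} -> nat).
Hypotheses (aF : almost_entropic (fun K => INR (F K))) (F_gt0 : (0 < F setT)%nat).

Local Notation k := (F setT).
Local Notation rho := (@port_rank M F).

Context (g : {set option (participant F)} -> R).
Hypotheses (pg : polymatroid g) (rg : realizes g (dual (port F))) (cg : complexity g = 1).

Let sigma := g [set None].
Let mono := proj1 (proj2 (proj2 pg)).
Let sub := proj2 (proj2 (proj2 pg)).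

Lemma mem_dual_port A : (A \in dual (port F)) = (rho (~: A) < k)%nat.
Proof. by rewrite !inE ltn_neqAle exp_rank_le_top andbT. Qed.

Let qualified A : (rho (~: A) < k)%nat -> g (with_secret A) = g (lift_set A).
Proof. by rewrite -mem_dual_port => h; apply/(rg A).1. Qed.

Let unqualified A : rho (~: A) = k -> g (with_secret A) = g (lift_set A) + sigma.
Proof. by move=> h; apply/(rg A).2; rewrite mem_dual_port h ltnn. Qed.

(** With a secret of value zero the two clauses of [realizes] would coincide, making [setT] both
    qualified and unqualified. *)
Lemma secret_gt0 : 0 < g [set None].
Proof.
have [_ [h _]] := pg; case: (h [set None]) => // s0.
have [_ [_ H]] := rg setT.
have : setT \notin dual (port F).
  by apply: H; rewrite -s0 Rplus_0_r; apply: qualified; rewrite setCT port_rank_set0.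
by rewrite mem_dual_port setCT port_rank_set0 // F_gt0.
Qed.

Let single_le e : g [set Some e] <= sigma.
Proof.
have := bigRmax_ge (fun e => g [set Some e] / g [set None]) e.
rewrite -/(complexity g) cg -/sigma => h.
have -> : g [set Some e] = g [set Some e] / sigma * sigma by field; have := secret_gt0; rewrite -/sigma; lra.
by have := secret_gt0; rewrite -/sigma; nra.
Qed.

Let with_secretU1 e A : with_secret (e |: A) = Some e |: with_secret A :> {set option (participant F)}.
Proof. by rewrite /with_secret /lift_set imsetU1 setUCA. Qed.

Let with_secret_mono (A B : {set participant F}) : A \subset B -> with_secret A \subset with_secret B.
Proof. by move=> s; apply: setUS; exact: imsetS. Qed.

Let lift_mono (A B : {set participant F}) : A \subset B -> lift_set A \subset lift_set B.
Proof. exact: imsetS. Qed.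

Let liftU1 e A : lift_set (e |: A) = Some e |: lift_set A :> {set option (participant F)}.
Proof. exact: imsetU1. Qed.

Let addU1 e J : g (Some e |: J) <= g J + sigma.
Proof.
have s : g (Some e |: J) + g ([set Some e] :&: J) <= g [set Some e] + g J by exact: sub.
have h0 : 0 <= g ([set Some e] :&: J) by have [_ [h _]] := pg; exact: h.
by have := single_le e; lra.
Qed.

(** Dual rank on the participants: the dual matroid on participants and secret, contracted by the
    secret. *)
Let rstar (A : {set participant F}) := INR #|A| + INR (rho (~: A)) - INR k.

(* If adding [e] does not raise the dual rank, then [e] lies in a minimal
   qualified set [C] inside [e |: A], the complement of a hyperplane. *)
Let step e (A : {set participant F}) : e \notin A ->
  g (with_secret (e |: A)) - g (with_secret A) <= sigma * (rstar (e |: A) - rstar A).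
Proof.
move=> eA; pose B := ~: (e |: A).
have eB : ~: A = e |: B.
  by apply/setP => x; rewrite !inE negb_or; case: (eqVneq x e) => [->|].
have -> : rstar (e |: A) - rstar A = 1 + INR (rho B) - INR (rho (e |: B)).
  by rewrite /rstar -eB -/B cardsU1 eA plus_INR /=; lra.
have := port_rank_unit e B; rewrite leq_eqVlt => /orP[/eqP h | h]; last first.
  have -> : rho (e |: B) = rho B.
    by apply/eqP; rewrite eqn_leq -ltnS h port_rank_mono // subsetUr.
  by rewrite with_secretU1; have := addU1 e (with_secret A); lra.
have [H [BH eH ltH topH]] := hyperplane_avoiding (@port_rank_mono M F) (@port_rank_unit M F)
   (port_rank_sub aF) h.
rewrite (port_rank_setT aF) in ltH topH; rewrite h S_INR.
pose C := ~: H; pose C' := ~: (e |: H).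
have eC : C = e |: C'.
  by apply/setP => x; rewrite !inE negb_or; case: (eqVneq x e) => [->|].
have C'A : C' \subset A.
  apply/subsetP => x; rewrite inE; apply: contraNT => xA; rewrite inE.
  case: (eqVneq x e) => [->|xe]; first by rewrite inE eqxx.
  by rewrite (subsetP BH) ?orbT // !inE negb_or xe.
(* [C] is qualified and [C'] is not, so given the secret and [C'] the participant [e] adds nothing;
   by submodularity it adds nothing given the secret and [A]. *)
have q1 : g (with_secret C) = g (lift_set C) by apply: qualified; rewrite setCK.
have q2 : g (with_secret C') = g (lift_set C') + sigma by apply: unqualified; rewrite setCK topH.
have q3 : g (lift_set C) <= g (lift_set C') + sigma by rewrite eC liftU1; exact: addU1.
have q4 : g (with_secret A :|: with_secret C) + g (with_secret A :&: with_secret C) <=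
  g (with_secret A) + g (with_secret C) by exact: sub.
have q5 : g (with_secret (e |: A)) <= g (with_secret A :|: with_secret C).
  apply: mono; rewrite with_secretU1 subUset subsetUl andbT sub1set in_setU eC with_secretU1.
  by rewrite setU11 orbT.
have q6 : g (with_secret C') <= g (with_secret A :&: with_secret C).
  by apply: mono; rewrite subsetI !with_secret_mono // eC subsetUr.
by lra.
Qed.

Let chain (A B : {set participant F}) : A \subset B ->
  g (with_secret B) - g (with_secret A) <= sigma * (rstar B - rstar A).
Proof.
move: {2}#|B :\: A| (erefl #|B :\: A|) => n.
elim: n B => [|n ih] B hB AB.
  have -> : B = A; last by lra.
  by apply/eqP; rewrite eqEsubset AB andbT -setD_eq0 -cards_eq0 hB.
have [e] : exists e, e \in B :\: A by apply/set0Pn; rewrite -card_gt0 hB.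
rewrite inE => /andP[eA eB].
have h1 : #|(B :\ e) :\: A| = n.
  apply/eqP; rewrite -eqSS -hB (cardsD1 e (B :\: A)) inE eA eB add1n eqSS.
  by apply/eqP/eq_card => x; rewrite !inE andbCA.
have := ih _ h1; rewrite subsetD1 AB eA => /(_ isT).
have eBe : e \notin B :\ e by rewrite !inE eqxx.
by have := step eBe; rewrite setD1K //; lra.
Qed.

Let Phi := block F setT.

Let generic_block : ~: Phi = generic F.
Proof. by rewrite /Phi -setC_generic setCK. Qed.

(** [Phi] is qualified but loses this when any [e] is removed, so [e] adds at least [sigma] to
    [Phi :\ e], and by submodularity to every smaller subset. Building up [Phi] one participant at a
    time gives the bound. *)
Let block_top : INR #|Phi| * sigma <= g (lift_set Phi).
Proof.
suff H n (D : {set participant F}) : #|D| = n -> D \subset Phi -> INR n * sigma <= g (lift_set D).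
  exact: H.
elim: n D => [|n ih] D hD DP; first by rewrite /= Rmult_0_l; have [_ [h _]] := pg; exact: h.
have [e eD] : exists e, e \in D by apply/set0Pn; rewrite -card_gt0 hD.
have cD : #|D :\ e| = n by apply/eqP; rewrite -eqSS -hD (cardsD1 e D) eD.
have := ih _ cD (subset_trans (subsetDl _ _) DP).
have eP : e \in Phi := subsetP DP _ eD.
have q1 : g (with_secret Phi) = g (lift_set Phi).
  by apply: qualified; rewrite generic_block; exact: port_rank_generic.
have q2 : g (with_secret (Phi :\ e)) = g (lift_set (Phi :\ e)) + sigma.
  apply: unqualified; rewrite setCD generic_block setUC port_rank_generic_add //.
  by rewrite -generic_block inE eP.
have q3 : g (with_secret (Phi :\ e)) <= g (with_secret Phi).
  by apply: mono; apply: with_secret_mono; exact: subsetDl.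
have q4 : g (lift_set (Phi :\ e) :|: lift_set D) + g (lift_set (Phi :\ e) :&: lift_set D) <=
  g (lift_set (Phi :\ e)) + g (lift_set D) by exact: sub.
have q5 : g (lift_set Phi) <= g (lift_set (Phi :\ e) :|: lift_set D).
  apply: mono; rewrite -{1}(setD1K eP) liftU1 subUset subsetUl andbT sub1set in_setU.
  by rewrite [X in _ || X](imset_f Some) ?orbT.
have q6 : g (lift_set (D :\ e)) <= g (lift_set (Phi :\ e) :&: lift_set D).
  by apply: mono; rewrite subsetI !lift_mono ?subsetDl // setSD.
by rewrite S_INR; lra.
Qed.

(** The increments of [chain] bound the value from above starting at [set0] and from below starting
    at [setT]. The bounds meet because [block_top] makes the value at [setT] as large as [chain]
    permits. *)
Lemma dual_port_realizer A :
  g (with_secret A) = g [set None] * (1 + INR #|A| + INR (rho (~: A)) - INR k).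
Proof.
have s0 : g (with_secret set0) = sigma by rewrite /with_secret /lift_set imset0 setU0.
have r0 : rstar set0 = 0 by rewrite /rstar cards0 setC0 port_rank_setT //=; lra.
(* There are [k.-1] generic participants, so subtracting [k] from the total leaves one less than the
   size of [Phi]. *)
have rT : rstar setT = INR #|Phi| - 1.
  rewrite /rstar setCT port_rank_set0 // cardsT -(cardsC Phi) generic_block card_generic plus_INR.
  by rewrite -{2}(prednK F_gt0) S_INR /=; lra.
have q1 : g (with_secret Phi) = g (lift_set Phi).
  by apply: qualified; rewrite generic_block; exact: port_rank_generic.
have q2 : g (with_secret Phi) <= g (with_secret setT).
  by apply: mono; apply: with_secret_mono; exact: subsetT.
have up := chain (sub0set A); have lo := chain (subsetT A).
have := block_top; rewrite s0 r0 in up; rewrite rT in lo.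
have -> : 1 + INR #|A| + INR (rho (~: A)) - INR k = 1 + rstar A by rewrite /rstar; lra.
by rewrite -/sigma; lra.
Qed.

End DualPort.

(** * The inequality on the dual port and the conclusion *)

Lemma setC_five xa xb xc xd xe :
  ~: five xa xb xc xd xe = five (~~ xa) (~~ xb) (~~ xc) (~~ xd) (~~ xe).
Proof. by apply/setP => i; rewrite !inE; case: i => [[|[|[|[|[|]]]]]]. Qed.

Lemma sum_five (G : nat -> nat) xa xb xc xd xe :
  (\sum_(i in five xa xb xc xd xe) G i =
   (if xa then G 0 else 0) + ((if xb then G 1 else 0) + ((if xc then G 2 else 0) +
   ((if xd then G 3 else 0) + (if xe then G 4 else 0)))))%nat.
Proof.
rewrite (eq_bigl (fun i : 'I_5 => nth false [:: xa; xb; xc; xd; xe] i)) => [|i]; last by rewrite inE.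
by rewrite big_mkcond !big_ord_recl big_ord0 /= addn0.
Qed.

Lemma card_generic_block (M : finType) (F : {set M} -> nat) K :
  #|generic F :|: block F K| = ((F setT).-1 + \sum_(i in K) F [set i])%nat.
Proof.
rewrite cardsU disjoint_setI0 ?cards0 ?subn0 ?card_generic ?card_block //.
by apply/pred0P => -[u|x]; rewrite /= !inE ?andbF.
Qed.

(** Given the secret and the generic participants, the blocks carry a multiple of the dual of [F],
    up to a constant. Every variable occurs in [mmrv] with total coefficient zero, so the singleton
    terms cancel and complementation leaves [mmrv_dual]. *)
Lemma dual_port_mmrv (F : {set 'I_5} -> nat) :
  almost_entropic (fun K => INR (F K)) -> (0 < F setT)%nat ->
  almost_ideal (dual (port F)) -> 0 <= mmrv_dual (fun K => INR (F K)).
Proof.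
move=> aF F0 [g [pg [ag [rg cg]]]].
pose s := g [set None]; have s0 : 0 < s := secret_gt0 aF F0 pg rg.
pose n (i : nat) := F [set inord i].
pose l (i : nat) := lift_set (block F [set inord i]).
pose Z := with_secret (generic F).
have joinE xa xb xc xd xe :
    join5 Z (l O) (l 1%nat) (l 2%nat) (l 3%nat) (l 4%nat) xa xb xc xd xe =
    with_secret (generic F :|: block F (five xa xb xc xd xe)).
  have inj : injective (@Some (participant F)) by move=> x y [].
  apply/setP => -[e|]; rewrite mem_join5; last by rewrite /Z /with_secret !setU11.
  rewrite /Z /with_secret /l /lift_set !in_setU !in_set1 /= !mem_imset //.
  case: e => [u|x]; rewrite !inE //= -!val_eqE /= !inordK //.
  by case: (tag u) => [[|[|[|[|[|]]]]]] //= _; rewrite ?andbT ?andbF ?orbF.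
pose m (x : bool) (i : nat) := if x then INR (n i) else 0.
have gE xa xb xc xd xe :
    g (join5 Z (l O) (l 1%nat) (l 2%nat) (l 3%nat) (l 4%nat) xa xb xc xd xe) =
    s * (m xa O + m xb 1%nat + m xc 2%nat + m xd 3%nat + m xe 4%nat
      + INR (F (five (~~ xa) (~~ xb) (~~ xc) (~~ xd) (~~ xe)))).
  rewrite joinE (dual_port_realizer aF F0 pg rg cg) setC_generic_block port_rank_block //.
  rewrite setC_five card_generic_block -{2}(prednK F0).
  rewrite (eq_bigr (fun i : 'I_5 => n i)) => [|i _]; last by rewrite /n inord_val.
  rewrite sum_five !plus_INR S_INR /m.
  by case: xa xb xc xd xe => [] [] [] [] [] /=; congr (_ * _); lra.
have dj i : (i < 4)%nat -> [disjoint l i & l 4%nat].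
  move=> i4; apply/pred0P => x /=; apply/negP => /andP[/imsetP[e he ->] /imsetP[e' he' [ee]]].
  move: he he'; rewrite -ee; case: e {ee} => [u|y]; rewrite !inE // => /eqP -> /eqP/(congr1 val).
  by rewrite /= !inordK ?(ltn_trans i4) // => e4; move: i4; rewrite e4.
have dZ : [disjoint Z & l 4%nat].
  apply/pred0P => x /=; apply/negP => /andP[+ /imsetP[e he ex]]; rewrite ex in_setU1 /=.
  by move=> /imsetP[e' he' [ee]]; move: he he'; rewrite -ee; case: e {ex ee} => [u|y]; rewrite !inE.
have := almost_entropic_mmrv (c := l 2%nat) (d := l 3%nat) ag dZ
  (dj O isT) (dj 1%nat isT) (dj 2%nat isT) (dj 3%nat isT).
rewrite /mmrv !gE /mmrv_dual /= => h.
apply: (Rmult_le_reg_l _ _ _ s0); rewrite Rmult_0_r; apply: Rle_trans h _.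
by right; rewrite /m; ring.
Qed.

Theorem theorem4p1 :
  exists (P : finType) (Acc : {set {set P}}),
    access_structure Acc /\ almost_ideal Acc /\ ~ almost_ideal (dual Acc).
Proof.
pose f := entropy cube_pmf cube_rv.
have ef : entropic f.
  apply/entropic_positive; exists (bool * bool * bool)%type, cube_pmf, cube_rv; split=> //.
  by split=> [w|]; rewrite ?sum_cube /cube_pmf; lra.
have af : almost_entropic f.
  by move=> eps eps0; exists f; split=> // A; rewrite Rminus_diag Rabs_R0.
have neg : mmrv_dual f < 0 := mmrv_dual_cube.
set T := INR #|{set 'I_5}|.
(* Rounding raises each value by at most [T], and the positive coefficients of [mmrv_dual] add up to
   11. *)
have [n hn] := INR_unbounded (11 * T / - mmrv_dual f).
have big : INR n * mmrv_dual f + 11 * T < 0.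
  have : 11 * T / - mmrv_dual f * - mmrv_dual f = 11 * T by field; lra.
  by nra.
have [F aF hF] := almost_entropic_round n af; rewrite -/T in hF.
have dneg : mmrv_dual (fun K => INR (F K)) < 0.
  apply: Rle_lt_trans big; rewrite /mmrv_dual.
  have := hF (five false true false true true); have := hF (five true false false true true).
  have := hF (five false true true false true); have := hF (five true false true false true).
  have := hF (five false false true true true); have := hF (five false true true true false).
  have := hF (five true false true true false); have := hF (five false false false true true).
  have := hF (five false false true false true); have := hF (five true true false false true).
  have := hF (five false true true true true); have := hF (five true false true true true).
  have := hF (five true true true true false); have := hF (five false false true true false).
  by move=> *; lra.
(* Otherwise monotonicity would make [F] identically zero, contradicting the strict violation. *)
have F_gt0 : (0 < F setT)%nat.
  rewrite lt0n; apply/eqP => FT; have [_ [ge0 [mono _]]] := almost_entropic_polymatroid aF.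
  have z A : INR (F A) = 0.
    by apply: Rle_antisym (ge0 A); have := mono _ _ (subsetT A); rewrite FT.
  by move: dneg; rewrite /mmrv_dual !z; lra.
exists (participant F), (port F); split; first exact: access_structure_port.
split; first exact: almost_ideal_port.
by move=> /(dual_port_mmrv aF F_gt0); lra.
Qed.
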